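(* Let $\Omega_0\subseteq\mathbb{C}$ be a bounded, connected, regular open set containing the origin and whose closure has connected complement. Let $\Omega=\exp^{-1}(\Omega_0)$. Then there exists an entire function $f\colon\mathbb{C}\to\mathbb{C}$ for which $\Omega$ is an escaping or oscillating wandering domain. The set $\Omega$ is unbounded and contains a half-plane, while the sets $f^n(\Omega)$, $n\ge1$, are bounded. Furthermore, the function $f|_\Omega\colon\Omega\to f(\Omega)$ is $\infty$-to-$1$, while the iterates $f^n|_{f(\Omega)}$ are univalent (injective).
   Context: An open set $\Omega$ is regular if it equals the interior of its closure. $f^n$ denotes the $n$-th iterate of $f$. The Fatou set of an entire function $f$ is the set of points $z\in\mathbb{C}$ having an open neighbourhood on which the family $(f^n)_{n\ge1}$ is normal (with values in $\widehat{\mathbb{C}}$). A Fatou component is a connected component of the Fatou set; a Fatou component $\Omega$ is a wandering domain if $f^n(\Omega)\cap f^m(\Omega)=\emptyset$ whenever $n\ne m$. The limit functions of the iterates $(f^n)$ on a wandering domain are constant; a wandering domain is escaping if $\infty$ is the only limit value, and oscillating if both $\infty$ and at least one finite value occur as limit values. *)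

(* Defs.v *)
From HB Require Import structures.
From mathcomp Require Import all_boot all_order all_algebra.
From mathcomp Require Import complex.
From mathcomp Require Import all_classical all_reals all_analysis.
Set Implicit Arguments.
Unset Strict Implicit.
Unset Printing Implicit Defensive.
Import Order.TTheory GRing.Theory Num.Theory.
Import numFieldNormedType.Exports.
Local Open Scope classical_set_scope.
Local Open Scope ring_scope.

(* [R[i]^o] is [R[i]] viewed as a normed module over itself: its topology is
   the Euclidean one and [derivable f z 1] is complex differentiability. *)
Notation Cplx R := (R[i]^o).

Definition entire (R : realType) (f : Cplx R -> Cplx R) : Prop :=
  forall z : Cplx R, derivable f z 1.

Definition cexp (R : realType) (z : Cplx R) : Cplx R :=
  Complex (expR (complex.Re z) * cos (complex.Im z))
          (expR (complex.Re z) * sin (complex.Im z)).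

Definition half_plane (R : realType) (H : set (Cplx R)) : Prop :=
  exists (a : R[i]) (c : R),
    a != 0 /\ H = [set z | complex.Re (a * z) < c].

(* The Riemann sphere, with [None] the point at infinity; its uniform structure
   is given by the chordal metric below. *)
Definition sphere (R : realType) : Type := one_point_compactification (Cplx R).

Definition cnorm (R : realType) (z : Cplx R) : R := ComplexField.Normc.normc z.

Definition chordal (R : realType) (p q : sphere R) : R :=
  match p, q with
  | Some z, Some w =>
      2 * cnorm (z - w) /
        (Num.sqrt (1 + cnorm z ^+ 2) * Num.sqrt (1 + cnorm w ^+ 2))
  | Some z, None | None, Some z => 2 / Num.sqrt (1 + cnorm z ^+ 2)
  | None, None => 0
  end.

(* Uniform convergence on compact subsets of U (equivalently, for open U,
   locally uniform convergence on U). Only the values of [h] on U matter. *)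
Definition cvg_compacts (R : realType) (U : set (Cplx R))
    (g : nat -> Cplx R -> sphere R) (h : Cplx R -> sphere R) : Prop :=
  forall K : set (Cplx R), K `<=` U -> compact K ->
  forall e : R, 0 < e ->
  \forall n \near \oo, forall z, K z -> chordal (g n z) (h z) < e.

Definition normal_family (R : realType) (U : set (Cplx R))
    (F : set (Cplx R -> sphere R)) : Prop :=
  forall s : nat -> Cplx R -> sphere R, (forall k, F (s k)) ->
  exists (phi : nat -> nat) (h : Cplx R -> sphere R),
    increasing_seq phi /\ cvg_compacts U (s \o phi) h.

Definition iterate (R : realType) (f : Cplx R -> Cplx R) (n : nat)
    (z : Cplx R) : sphere R := Some (iter n f z).

Definition fatou_set (R : realType) (f : Cplx R -> Cplx R) : set (Cplx R) :=
  [set z | exists U : set (Cplx R), [/\ open U, U z &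
    normal_family U [set iterate f n | n in [set n | (1 <= n)%N]]]].

Definition fatou_component (R : realType) (f : Cplx R -> Cplx R)
    (U : set (Cplx R)) : Prop :=
  exists2 z, fatou_set f z & U = connected_component (fatou_set f) z.

Definition wandering_domain (R : realType) (f : Cplx R -> Cplx R)
    (U : set (Cplx R)) : Prop :=
  fatou_component f U /\
  forall m n : nat, m <> n -> (iter m f @` U) `&` (iter n f @` U) = set0.

(* Limit functions of the iterates on a wandering domain are constant, so limit
   values are the constants that arise as limit functions. *)
Definition limit_value (R : realType) (f : Cplx R -> Cplx R)
    (U : set (Cplx R)) (a : sphere R) : Prop :=
  exists phi : nat -> nat,
    increasing_seq phi /\ cvg_compacts U (iterate f \o phi) (fun=> a).

Definition escaping_wandering_domain (R : realType) (f : Cplx R -> Cplx R)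
    (U : set (Cplx R)) : Prop :=
  wandering_domain f U /\ forall a, limit_value f U a <-> a = None.

Definition oscillating_wandering_domain (R : realType) (f : Cplx R -> Cplx R)
    (U : set (Cplx R)) : Prop :=
  [/\ wandering_domain f U, limit_value f U None
    & exists a : Cplx R, limit_value f U (Some a)].

(* Main.v *)
(** The function is [f = h o cexp] with [h] entire.  Put [Gamma_n = (cexp o h)^n],
    so that [f^(n+1) = h o Gamma_n o cexp], and let [K] be the closure of [Omega0].
    One builds [h] as a limit of functions [h_n] such that [h_n] maps the
    successive images [Gamma_j K] injectively into small discs around real points
    [c_j] tending to infinity, while points [u_n] outside [K], dense near the
    frontier of [K], satisfy [|h (Gamma_n u_n)| <= 2].  Hence the iterates tend to
    infinity uniformly on [Omega], but no limit function can be continuous at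
    a boundary point, and [Omega] is a full Fatou component.

    To extend [h_n] one needs a function close to an affine map on [Gamma_n K]
    and close to [0] at [Gamma_n u_n].  Connectedness of the complement of [K]
    gives a polynomial that is [1] at [u_n] and small on [K]; it is transported to
    [Gamma_n K] through an entire approximate left inverse of [Gamma_n] near [K],
    whose existence is carried along the induction.  Iterates of
    [3 t^2 - 2 t^3], which converge to [0] near [0] and to [1] near [1], glue the
    extension to [h_n] on a large disc. *)

(* The induction must carry a property that survives infinitely many later corrections. Injectivity
   on [K] by itself has no quantitative margin. A [J] with [J o Gamma_n] uniformly close to the
   identity on a whole neighbourhood of [K] has one, and Cauchy estimates turn this closeness into a
   contraction, hence into injectivity. Stability also requires every correction to be tiny wherever
   earlier orbit points lie: the targets [ctr n] grow so fast after exponentiation that the discs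
   around all earlier images of [K] fit into a disc about [0] disjoint from the one where the
   function is redefined. Two hypotheses on [Omega0] enter only at the end. Regularity makes every
   frontier point of [Omega0] a limit of points outside [K], where returning orbits can be placed.
   The origin in [Omega0] makes the preimage under [cexp] connected, since it then contains a left
   half-plane. *)
Require Import Defs.
From HB Require Import structures.
From mathcomp Require Import all_boot all_order all_algebra.
From mathcomp Require Import complex.
From mathcomp Require Import all_classical all_reals all_analysis.
From mathcomp Require Import cyclic separable cyclotomic.
From mathcomp Require Import ring lra zify.
Set Implicit Arguments.
Unset Strict Implicit.
Unset Printing Implicit Defensive.
Import Order.TTheory GRing.Theory Num.Theory.
Import numFieldNormedType.Exports.
Local Open Scope classical_set_scope.
Local Open Scope ring_scope.
Local Open Scope complex_scope.

(** * Modulus and topology of the complex plane *)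

Section Cnorm.
Context (R : realType).
Implicit Types (x y z w : R[i]).
Local Notation N := (@cnorm R).

Lemma cnormE z : `|z| = (N z)%:C.
Proof. by rewrite normc_def; case: z. Qed.

Lemma cnorm_ge0 z : 0 <= N z.
Proof. by rewrite -ler0c -cnormE. Qed.

Lemma cnorm0 : N 0 = 0.
Proof. exact: ComplexField.Normc.normc0. Qed.

Lemma cnorm1 : N 1 = 1.
Proof. exact: ComplexField.Normc.normc1. Qed.

Lemma cnormM z w : N (z * w) = N z * N w.
Proof. exact: ComplexField.Normc.normcM. Qed.

Lemma cnormN z : N (- z) = N z.
Proof. by apply: complexI; rewrite -!cnormE normrN. Qed.

Lemma cnormB z w : N (z - w) = N (w - z).
Proof. by rewrite -cnormN opprB. Qed.

Lemma cnormV z : N z^-1 = (N z)^-1.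
Proof. exact: ComplexField.Normc.normcV. Qed.

Lemma cnormX z n : N (z ^+ n) = N z ^+ n.
Proof. by elim: n => [|n IH]; rewrite ?expr0 ?cnorm1// !exprS cnormM IH. Qed.

Lemma cnormD z w : N (z + w) <= N z + N w.
Proof. by rewrite -lecR rmorphD /= -!cnormE ler_normD. Qed.

Lemma cnormBD z w : N (z - w) <= N z + N w.
Proof. by rewrite -(cnormN w) cnormD. Qed.

Lemma cnormD3 x y z : N (x - z) <= N (x - y) + N (y - z).
Proof. by apply: le_trans (cnormD _ _); rewrite addrA subrK. Qed.

Lemma cnormB_ge z w : N z - N w <= N (z - w).
Proof. by rewrite lerBlDr; apply: le_trans (cnormD _ _); rewrite subrK. Qed.

Lemma cnorm_eq0 z : (N z == 0) = (z == 0).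
Proof.
by apply/eqP/eqP => [/ComplexField.Normc.eq0_normc//|->]; rewrite cnorm0.
Qed.

Lemma cnorm_le0 z : N z <= 0 -> z = 0.
Proof. by move=> h; apply/eqP; rewrite -cnorm_eq0 eq_le h cnorm_ge0. Qed.

Lemma cnorm_gt0 z : (0 < N z) = (z != 0).
Proof. by rewrite lt_def cnorm_ge0 andbT cnorm_eq0. Qed.

Lemma cnorm_sum (I : Type) (s : seq I) (P : pred I) (F : I -> R[i]) :
  N (\sum_(i <- s | P i) F i) <= \sum_(i <- s | P i) N (F i).
Proof.
elim/big_rec2: _ => [|i a b _ h]; first by rewrite cnorm0.
by apply: le_trans (cnormD _ _) _; rewrite lerD2l.
Qed.

Lemma cnorm_real (a : R) : N a%:C = `|a|.
Proof. by rewrite /cnorm /ComplexField.Normc.normc /= expr0n addr0 sqrtr_sqr. Qed.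

Lemma cnorm_realp (a : R) : 0 <= a -> N a%:C = a.
Proof. by move=> h; rewrite cnorm_real ger0_norm. Qed.

Lemma cnorm_nat n : N n%:R = n%:R.
Proof. by rewrite -(rmorph_nat (real_complex R)) cnorm_realp. Qed.

Lemma normr_Re z : `|complex.Re z| <= N z.
Proof. by rewrite -lecR -cnormE; exact: normc_ge_Re. Qed.

Lemma normr_Im z : `|complex.Im z| <= N z.
Proof.
case: z => a b; rewrite /cnorm /ComplexField.Normc.normc /= -(sqrtr_sqr b).
by rewrite ler_sqrt ?addr_ge0 ?sqr_ge0// lerDr sqr_ge0.
Qed.

Lemma cnorm_le_ReIm z : N z <= `|complex.Re z| + `|complex.Im z|.
Proof.
rewrite {1}(complexE z); apply: le_trans (cnormD _ _) _.
rewrite cnorm_real lerD2l cnormM cnorm_real.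
by rewrite {1}/cnorm /ComplexField.Normc.normc /= expr0n add0r expr1n sqrtr1 mul1r.
Qed.

End Cnorm.

Section Topology.
Context (R : realType).
Local Notation N := (@cnorm R).
Local Notation C := (Cplx R).
Implicit Types (x y z w : C).

Lemma nbhs_cnormP (z : C) (A : set C) :
  nbhs z A <-> exists2 e : R, 0 < e & forall w, N (w - z) < e -> A w.
Proof.
split.
- move=> /nbhs_ballP[e /= e0 H]; have [k ek] : exists k, e = k%:C.
    by apply/complex_realP; rewrite gtr0_real.
  exists k; first by rewrite -ltcR -ek.
  move=> w h; apply: H; rewrite -ball_normE /= cnormE cnormB ek.
  by rewrite ltcR.
- move=> [e e0 H]; apply/nbhs_ballP; exists (e%:C) => /=; first by rewrite ltcR.
  move=> w; rewrite -ball_normE /= cnormE ltcR => h; apply: H.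
  by rewrite cnormB.
Qed.

Lemma open_cnormP (A : set C) :
  open A <-> forall z, A z -> exists2 e : R, 0 < e & forall w, N (w - z) < e -> A w.
Proof.
rewrite openE; split => [H z /H /nbhs_cnormP//|H z /H h].
exact/nbhs_cnormP.
Qed.

Lemma closure_cnormP (A : set C) z :
  closure A z <-> forall e : R, 0 < e -> exists2 w, A w & N (w - z) < e.
Proof.
split.
- move=> H e e0.
  have [|w [Aw]] := H [set w | N (w - z) < e].
    by apply/nbhs_cnormP; exists e.
  by exists w.
- move=> H B /nbhs_cnormP[e e0 hB]; have [w Aw h] := H _ e0.
  by exists w; split => //; exact: hB.
Qed.

Lemma bounded_cnormP (A : set C) :
  bounded_set A <-> exists M : R, forall z, A z -> N z <= M.
Proof.
split.
- case=> M [Mr H].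
  have [k ek] : exists k, M = k%:C by apply/complex_realP.
  exists (k + 1) => z Az; have := H ((k + 1)%:C).
  rewrite ek ltcR ltrDl ltr01 => /(_ isT) /(_ _ Az) /=.
  by rewrite cnormE lecR.
- case=> M H; exists (M%:C); split; first by apply/complex_realP; exists M.
  move=> x Mx z Az; rewrite /= cnormE; apply: le_trans (ltW Mx).
  by rewrite lecR; exact: H.
Qed.

Lemma continuous_cnormP (f : C -> C) z : {for z, continuous f} <->
  forall e : R, 0 < e -> exists2 d : R, 0 < d &
    forall w, N (w - z) < d -> N (f w - f z) < e.
Proof.
split.
- move=> H e e0.
  have /nbhs_cnormP[d d0 h] : nbhs z (f @^-1` [set w | N (w - f z) < e]).
    by apply: H; apply/nbhs_cnormP; exists e.
  by exists d.
- move=> H A /nbhs_cnormP[e e0 hA]; have [d d0 hd] := H _ e0.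
  by apply/nbhs_cnormP; exists d => // w /hd; exact: hA.
Qed.

End Topology.

(** * Cauchy estimates for polynomials *)

Section Cauchy.
Context (R : realType).
Local Notation N := (@cnorm R).
Implicit Types (p q : {poly R[i]}) (z w : R[i]).

Lemma real_cauchy_cvg (u : nat -> R) :
  (forall e : R, 0 < e -> exists n0, forall n, (n0 <= n)%N -> `|u n0 - u n| <= e) ->
  exists l, forall e : R, 0 < e -> exists n0, forall n, (n0 <= n)%N -> `|u n - l| <= e.
Proof.
move=> H; have cu : cvgn u.
  apply/cauchy_cvgP/cauchy_exP => e e0.
  have [|n0 Hn] := H (e / 2); first lra.
  exists (u n0); exists n0 => // n /= /Hn h; rewrite -ball_normE /=.
  by apply: le_lt_trans h _; lra.
exists (limn u) => e e0; move/cvgrPdist_le : cu => /(_ _ e0)[n0 _ Hn].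
by exists n0 => n h; rewrite distrC; exact: Hn.
Qed.

Lemma complex_cauchy_cvg (u : nat -> R[i]) :
  (forall e : R, 0 < e -> exists n0, forall n, (n0 <= n)%N -> N (u n0 - u n) <= e) ->
  exists l, forall e : R, 0 < e -> exists n0, forall n, (n0 <= n)%N -> N (u n - l) <= e.
Proof.
move=> H.
have [|a Ha] := @real_cauchy_cvg (fun n => complex.Re (u n)).
  move=> e /H[n0 h]; exists n0 => n /h; apply: le_trans.
  by rewrite -(raddfB (@complex.Re R)) normr_Re.
have [|b Hb] := @real_cauchy_cvg (fun n => complex.Im (u n)).
  move=> e /H[n0 h]; exists n0 => n /h; apply: le_trans.
  by rewrite -(raddfB (@complex.Im R)) normr_Im.
exists (Complex a b) => e e0.
have [|n1 h1] := Ha (e / 2); first lra.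
have [|n2 h2] := Hb (e / 2); first lra.
exists (maxn n1 n2) => n; rewrite geq_max => /andP[/h1 k1 /h2 k2].
apply: le_trans (cnorm_le_ReIm _) _.
by rewrite !raddfB /=; lra.
Qed.

Lemma prim_root_exists n : (0 < n)%N -> exists z : R[i], n.-primitive_root z.
Proof.
move=> n_gt0; pose p : {poly R[i]} := 'X^n - 1.
have [r] := closed_field_poly_normal p.
rewrite (monicP _) ?monicXnsubC // scale1r => Dp.
have rn1 : all n.-unity_root r.
  by apply/allP => z; rewrite -root_prod_XsubC -Dp.
have sz_r : (n < (size r).+1)%N.
  by rewrite -(size_prod_XsubC r id) -Dp size_XnsubC.
have [|z] := hasP (has_prim_root n_gt0 rn1 _ sz_r); last by exists z.
rewrite -separable_prod_XsubC -Dp separable_Xn_sub_1 // pnatr_eq0.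
by rewrite -lt0n.
Qed.

(* The coefficient is an average of values of [p] over rotated [n]-th roots of
   unity, a discrete Cauchy integral. *)
Lemma poly_coef_le p (rho M : R) : 0 < rho ->
  (forall z, N z <= rho -> N p.[z] <= M) -> forall k, N p`_k * rho ^+ k <= M.
Proof.
move=> rho0 H k.
have M0 : 0 <= M.
  by apply: le_trans (cnorm_ge0 _) (H 0 _); rewrite cnorm0 ltW.
have [kn|nk] := leqP (size p) k.
  by rewrite nth_default// cnorm0 mul0r.
set n := size p in nk *.
have n0 : (0 < n)%N by exact: leq_ltn_trans nk.
have [w pw] := prim_root_exists n0.
have wn := prim_expr_order pw.
have Nw : N w = 1.
  apply/eqP; rewrite -(@pexpr_eq1 _ (N w) n) ?cnorm_ge0//.
  by rewrite -cnormX wn cnorm1.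
(* Orthogonality of characters; the exponent [n - k] plays the role of [-k]. *)
have sumw m : (m < n)%N ->
    \sum_(j < n) (w ^+ j) ^+ (n - k) * (w ^+ j) ^+ m = (m == k)%:R * n%:R.
  move=> mn; have [->|mk] := eqVneq m k.
    rewrite mul1r (eq_bigr (fun=> 1)) ?sumr_const ?card_ord// => j _.
    by rewrite -exprD subnK 1?ltnW// -exprM mulnC exprM wn expr1n.
  rewrite mul0r; set x := w ^+ (n - k + m).
  have x1 : x != 1.
    rewrite -(prim_order_dvd pw); apply/negP => /dvdnP[c hc].
    (* A multiple of [n] strictly between [0] and [2 * n] is [n] itself, which forces [m = k]. *)
    have : c = 1%N by move: hc mn nk; case: c => [|[|c]] //=; nia.
    by move=> c1; move: hc mk; rewrite c1; lia.
  have : (x - 1) * \sum_(j < n) x ^+ j = 0.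
    by rewrite -subrX1 -exprM mulnC exprM wn expr1n subrr.
  move/eqP; rewrite mulf_eq0 subr_eq0 (negbTE x1) /= => /eqP s0; rewrite -[RHS]s0.
  by apply: eq_bigr => j _; rewrite -exprD -!exprM mulnC.
have key : n%:R * (p`_k * (rho%:C) ^+ k) =
    \sum_(j < n) (w ^+ j) ^+ (n - k) * p.[rho%:C * w ^+ j].
  under eq_bigr => j _ do rewrite horner_coef mulr_sumr.
  rewrite exchange_big /= (bigD1 (Ordinal nk))//= [X in _ + X]big1 ?addr0.
    under eq_bigr => j _ do
      rewrite exprMn mulrCA [X in _ * X]mulrCA mulrA.
    by rewrite -mulr_sumr sumw// eqxx mul1r mulrC.
  move=> i ik; under eq_bigr => j _ do
      rewrite exprMn mulrCA [X in _ * X]mulrCA mulrA.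
  rewrite -mulr_sumr sumw//; have -> : (i == k :> nat) = false.
    by apply/negbTE.
  by rewrite mul0r mulr0.
have : n%:R * (N p`_k * rho ^+ k) <= n%:R * M.
  have -> : n%:R * (N p`_k * rho ^+ k) = N (n%:R * (p`_k * rho%:C ^+ k)).
    by rewrite !cnormM cnormX cnorm_nat cnorm_realp ?(ltW rho0).
  rewrite key.
  apply: le_trans (cnorm_sum _ _ _) _.
  have -> : n%:R * M = \sum_(j < n) M.
    by rewrite sumr_const card_ord mulr_natl.
  apply: ler_sum => j _.
  rewrite cnormM !cnormX Nw !expr1n mul1r; apply: H.
  by rewrite cnormM cnorm_realp ?(ltW rho0)// cnormX Nw expr1n mulr1.
by rewrite ler_pM2l// ltr0n.
Qed.

Lemma poly_tail_le p (rho M : R) m z : 0 < rho -> N z <= rho / 2 ->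
  (forall k, N p`_k * rho ^+ k <= M) ->
  N (\sum_(m <= k < maxn m (size p)) p`_k * z ^+ k) <= 2 * M * (N z / rho) ^+ m.
Proof.
move=> rho0 hz H; set t := N z / rho.
have t0 : 0 <= t by rewrite divr_ge0 ?cnorm_ge0 ?ltW.
have t2 : t <= 1 / 2 by rewrite ler_pdivrMr//; lra.
have M0 : 0 <= M by apply: le_trans (H 0%N); rewrite mulr_ge0 ?cnorm_ge0// exprn_ge0 ?ltW.
have ht k : N (p`_k * z ^+ k) <= M * t ^+ k.
  rewrite cnormM cnormX /t expr_div_n mulrA ler_pdivlMr ?exprn_gt0//.
  by rewrite mulrAC ler_wpM2r ?exprn_ge0 ?cnorm_ge0.
apply: le_trans (cnorm_sum _ _ _) _.
(* The subtracted tail makes the induction close: as [t <= 1 / 2], each term [M * t ^+ k] is paid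
   for by the drop of [2 * M * t ^+ k] to the next power. *)
have : forall n, \sum_(m <= k < m + n) N (p`_k * z ^+ k) <= 2 * M * t ^+ m - 2 * M * t ^+ (m + n).
  elim=> [|n IH]; first by rewrite addn0 big_geq// subrr.
  rewrite addnS big_nat_recr ?leq_addr//=.
  have h := ht (m + n)%N.
  have : t ^+ (m + n).+1 <= t ^+ (m + n) / 2.
    by rewrite exprS; have h0 := exprn_ge0 (m + n) t0; nra.
  move: IH h; set a := \sum_(_ <= _ < _) _; set b := N _; set c := t ^+ (m + n).+1.
  by set d := t ^+ (m + n) => h1 h2 h3; nra.
move=> /(_ (maxn m (size p) - m)%N); rewrite subnKC ?leq_maxl// => h.
by apply: le_trans h _; rewrite gerBl mulr_ge0 ?exprn_ge0// mulr_ge0.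
Qed.

Lemma poly_sub0 p z : p.[z] - p.[0] = \sum_(1 <= k < maxn 1 (size p)) p`_k * z ^+ k.
Proof.
have h : (size p <= maxn 1 (size p))%N by rewrite leq_maxr.
rewrite horner_coef0 (horner_coef_wide _ h) -(big_mkord xpredT (fun i => p`_i * z ^+ i)).
by rewrite big_ltn ?leq_max// expr0 mulr1 addrAC subrr add0r.
Qed.

Lemma poly_sub1 p z :
  p.[z] - p.[0] - p`_1 * z = \sum_(2 <= k < maxn 2 (size p)) p`_k * z ^+ k.
Proof.
have h : (size p <= maxn 2 (size p))%N by rewrite leq_maxr.
rewrite horner_coef0 (horner_coef_wide _ h) -(big_mkord xpredT (fun i => p`_i * z ^+ i)).
rewrite big_ltn ?leq_max// big_ltn ?leq_max//  expr0 expr1 mulr1.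
by ring.
Qed.

(** Points more than [rho / 4] apart satisfy it by the trivial bound [2 * M]. Otherwise [p] is
    recentred at [w], whose disc of radius [rho / 2] lies in the given one, and the tail estimate
    from degree 1 applies. *)
Lemma poly_lip p a (rho M : R) : 0 < rho ->
  (forall z, N (z - a) <= rho -> N p.[z] <= M) ->
  forall z w, N (z - a) <= rho / 2 -> N (w - a) <= rho / 2 ->
  N (p.[z] - p.[w]) <= 8 * M / rho * N (z - w).
Proof.
move=> rho0 H z w hz hw.
have [zw|zw] := leP (N (z - w)) (rho / 4); last first.
  have h1 : N p.[z] <= M by apply: H; lra.
  have h2 : N p.[w] <= M by apply: H; lra.
  apply: le_trans (cnormBD _ _) _.
  have M0 : 0 <= M by apply: le_trans (cnorm_ge0 _) h1.
  rewrite mulrAC ler_pdivlMr//; nra.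
pose q := p \Po ('X + w%:P).
have hq x : q.[x] = p.[x + w] by rewrite horner_comp hornerD hornerX hornerC.
have -> : p.[z] - p.[w] = q.[z - w] - q.[0] by rewrite !hq subrK add0r.
rewrite poly_sub0; apply: le_trans (@poly_tail_le q (rho / 2) M 1 (z - w) _ _ _) _.
- lra.
- lra.
- apply: poly_coef_le; first lra.
  move=> x hx; rewrite hq; apply: H.
  by rewrite -addrA; apply: le_trans (cnormD _ _) _; lra.
- have M0 : 0 <= M by apply: le_trans (cnorm_ge0 _) (H z _); lra.
  have h0 : 0 <= M / rho * N (z - w) by rewrite mulr_ge0 ?cnorm_ge0// divr_ge0// ltW.
  have -> : 2 * M * (N (z - w) / (rho / 2)) ^+ 1 = 4 * (M / rho * N (z - w)).
    by field; lra.
  have -> : 8 * M / rho * N (z - w) = 8 * (M / rho * N (z - w)) by ring.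
  lra.
Qed.

(** The error depends on [p] only through [M], so the estimate passes to uniform limits of
    polynomials. *)
Lemma poly_diff p a (M : R) :
  (forall z, N (z - a) <= 1 -> N p.[z] <= M) ->
  forall z, N (z - a) <= 1 / 2 ->
  N (p.[z] - p.[a] - p^`().[a] * (z - a)) <= 2 * M * N (z - a) ^+ 2.
Proof.
move=> H z hz; pose q := p \Po ('X + a%:P).
have hq x : q.[x] = p.[x + a] by rewrite horner_comp hornerD hornerX hornerC.
have q1 : q`_1 = p^`().[a].
  rewrite -[q`_1]mulr1n -coef_deriv -horner_coef0 deriv_comp derivD derivX derivC addr0.
  by rewrite mulr1 horner_comp hornerD hornerX hornerC add0r.
have -> : p.[z] - p.[a] = q.[z - a] - q.[0] by rewrite !hq subrK add0r.
rewrite -q1 poly_sub1.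
apply: le_trans (@poly_tail_le q 1 M 2 (z - a) _ _ _) _ => //.
  apply: poly_coef_le => // x hx; rewrite hq; apply: H.
  by rewrite addrK.
by rewrite divr1.
Qed.

Lemma poly_deriv_le p a (M : R) :
  (forall z, N (z - a) <= 1 -> N p.[z] <= M) -> N p^`().[a] <= M.
Proof.
move=> H; pose q := p \Po ('X + a%:P).
have hq x : q.[x] = p.[x + a] by rewrite horner_comp hornerD hornerX hornerC.
have <- : q`_1 = p^`().[a].
  rewrite -[q`_1]mulr1n -coef_deriv -horner_coef0 deriv_comp derivD derivX derivC addr0.
  by rewrite mulr1 horner_comp hornerD hornerX hornerC add0r.
have := @poly_coef_le q 1 M ltr01; rewrite -[X in X <= _]mulr1 -{2}(expr1n R 1).
by apply=> x hx; rewrite hq; apply: H; rewrite addrK.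
Qed.

End Cauchy.

(** * The complex exponential *)

Section Cexp.
Context (R : realType).
Local Notation N := (@cnorm R).
Implicit Types (z w : R[i]) (x : R).

Lemma cexp0 : cexp 0 = 1 :> R[i].
Proof. by rewrite /cexp /= expR0 cos0 sin0 mulr0 mulr1. Qed.

Lemma cexpD z w : cexp (z + w) = cexp z * cexp w.
Proof.
case: z w => [a b] [c d]; rewrite /cexp /=; simpc.
by rewrite expRD cosD sinD; congr Complex; ring.
Qed.

Lemma cnorm_cexp z : N (cexp z) = expR (complex.Re z).
Proof.
rewrite /cexp /cnorm /ComplexField.Normc.normc !exprMn -mulrDr cos2Dsin2 mulr1.
by rewrite sqrtr_sqr ger0_norm ?expR_ge0.
Qed.

Lemma cexp_neq0 z : cexp z != 0 :> R[i].
Proof. by rewrite -cnorm_gt0 cnorm_cexp expR_gt0. Qed.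

Lemma cexp_real x : cexp x%:C = (expR x)%:C.
Proof. by rewrite /cexp /= cos0 sin0 mulr0 mulr1. Qed.

Lemma cexpMn z n : cexp (n%:R * z) = cexp z ^+ n.
Proof.
elim: n => [|n IH]; first by rewrite mul0r cexp0.
by rewrite -nat1r mulrDl mul1r cexpD IH exprS.
Qed.

Lemma cnorm_cexp_le z : N (cexp z) <= expR (N z).
Proof.
rewrite cnorm_cexp ler_expR; apply: le_trans (normr_Re z); exact: ler_norm.
Qed.

Lemma sin_le x : `|sin x| <= `|x|.
Proof.
wlog x0 : x / 0 <= x.
  move=> H; have [/H//|/ltW x0] := leP 0 x.
  by rewrite -normrN -(normrN x) -sinN H// oppr_ge0.
have [c _] := @MVT_segment R sin cos 0 x x0 (fun y _ => is_derive_sin y)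
  (continuous_subspaceT (@continuous_sin R)).
rewrite sin0 !subr0 => ->; rewrite normrM ler_piMl// ler_norml.
by rewrite cos_geN1 cos_le1.
Qed.

Lemma cos_sub1_le x : `|cos x - 1| <= x ^+ 2.
Proof.
wlog x0 : x / 0 <= x.
  move=> H; have [/H//|/ltW x0] := leP 0 x.
  by rewrite -cosN -sqrrN H// oppr_ge0.
have [c] := @MVT_segment R cos (fun y => - sin y) 0 x x0 (fun y _ => is_derive_cos y)
  (continuous_subspaceT (@continuous_cos R)).
rewrite in_itv /= => /andP[c0 cx].
rewrite cos0 subr0 => ->; rewrite normrM normrN expr2 (ger0_norm x0).
rewrite ler_wpM2r//; apply: le_trans (sin_le c) _.
by rewrite ger0_norm.
Qed.

Lemma sin_subid_le x : `|sin x - x| <= `|x| ^+ 3.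
Proof.
wlog x0 : x / 0 <= x.
  move=> H; have [/H//|/ltW x0] := leP 0 x.
  by rewrite -normrN -(normrN x) opprD -sinN H// oppr_ge0.
have [|c] := @MVT_segment R (fun y => sin y - y) (fun y => cos y - 1) 0 x x0
    (fun y _ => is_deriveB (is_derive_sin y) (is_derive_id y 1)).
  by apply: continuous_subspaceT => y; apply: continuousB;
    [exact: continuous_sin|exact: id].
rewrite in_itv /= => /andP[c0 cx].
rewrite sin0 !subr0 => ->; rewrite normrM exprSr (ger0_norm x0).
rewrite ler_wpM2r//; apply: le_trans (cos_sub1_le c) _.
by rewrite ler_sqr ?nnegrE.
Qed.

(** The upper bound comes from the lower bound [1 - x <= expR (- x)]: thus [expR x * (1 - x) <= 1],
    and [1] is at most [(1 - x) * (1 + x + 2 * x ^+ 2)] when [x <= 1 / 2]. *)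
Lemma expR_quad x : `|x| <= 1 / 2 -> 0 <= expR x - 1 - x <= 2 * x ^+ 2.
Proof.
rewrite ler_norml => /andP[x1 x2]; have h1 := expR_ge1Dx x; have h2 := expR_ge1Dx (- x).
have h3 : expR x * expR (- x) = 1 by rewrite -expRD subrr expR0.
have h4 : expR x * (1 - x) <= 1.
  by rewrite -[leRHS]h3 ler_wpM2l ?expR_ge0; lra.
have h5 : 1 <= (1 - x) * (1 + x + 2 * x ^+ 2) by nra.
have h6 : expR x * (1 - x) <= (1 + x + 2 * x ^+ 2) * (1 - x).
  by apply: le_trans h4 _; rewrite mulrC.
rewrite ler_pM2r in h6; last lra.
by apply/andP; split; lra.
Qed.

Lemma cnorm_sqr z : N z ^+ 2 = complex.Re z ^+ 2 + complex.Im z ^+ 2.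
Proof. by case: z => a b; rewrite sqr_sqrtr ?addr_ge0 ?sqr_ge0. Qed.

Lemma cexp_quad z : N z <= 1 / 2 -> N (cexp z - 1 - z) <= 4 * N z ^+ 2.
Proof.
move=> hz; have ha := le_trans (normr_Re z) hz; have hb := le_trans (normr_Im z) hz.
apply: le_trans (cnorm_le_ReIm _) _; rewrite cnorm_sqr.
case: z ha hb {hz} => a b /= ha hb.
have /andP[e1 e2] := expR_quad ha; have c := cos_sub1_le b.
have s := sin_subid_le b.
have a2 : `|a| ^+ 2 = a ^+ 2 by rewrite real_normK ?num_real.
have b2 : `|b| ^+ 2 = b ^+ 2 by rewrite real_normK ?num_real.
have hs : `|sin b - b| <= `|b| * b ^+ 2 by rewrite -b2 -exprS.
have /andP[a0 a1] : - (1 / 2) <= a <= 1 / 2 by rewrite -ler_norml.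
have e0 := expR_ge0 a; have eb : expR a <= 2 by nra.
have ea : `|expR a - 1| <= 2 * `|a|.
  rewrite ler_norml; move: (ler_norm a) (ler_norm (- a)); rewrite normrN => u v.
  have v0 := normr_ge0 a; have a22 : a ^+ 2 <= 1 / 2 * `|a| by rewrite -a2 expr2 ler_wpM2r.
  by apply/andP; split; lra.
have -> : expR a * cos b - 1 - a = (expR a - 1 - a) + expR a * (cos b - 1) by ring.
have -> : expR a * sin b - 0 - b = expR a * (sin b - b) + (expR a - 1) * b by ring.
have t1 := ler_normD (expR a - 1 - a) (expR a * (cos b - 1)).
have t2 := ler_normD (expR a * (sin b - b)) ((expR a - 1) * b).
rewrite !normrM (ger0_norm e0) (ger0_norm e1) in t1 t2.
have n1 : expR a * `|cos b - 1| <= 2 * b ^+ 2 by apply: ler_pM.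
have n2 : expR a * `|sin b - b| <= 2 * (`|b| * b ^+ 2) by apply: ler_pM.
have n3 : `|expR a - 1| * `|b| <= 2 * `|a| * `|b| by rewrite ler_wpM2r.
have n4 : `|b| * b ^+ 2 <= 1 / 2 * b ^+ 2 by rewrite ler_wpM2r ?sqr_ge0.
have n5 : 2 * `|a| * `|b| <= a ^+ 2 + b ^+ 2.
  by rewrite -a2 -b2; have := sqr_ge0 (`|a| - `|b|); rewrite sqrrB; lra.
by lra.
Qed.

Lemma cexp_sub1 z : N z <= 1 / 8 -> N (cexp z - 1) <= 2 * N z.
Proof.
move=> h; have h1 : N (cexp z - 1 - z) <= 4 * N z ^+ 2 by apply: cexp_quad; lra.
have := cnormD (cexp z - 1 - z) z; rewrite subrK => h2.
by have := cnorm_ge0 z; nra.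
Qed.

Lemma cnormB_exp z w (M : R) n : N z <= M -> N w <= M ->
  N (z ^+ n.+1 - w ^+ n.+1) <= n.+1%:R * M ^+ n * N (z - w).
Proof.
move=> hz hw; have M0 := le_trans (cnorm_ge0 z) hz.
rewrite subrXX cnormM mulrC ler_wpM2r ?cnorm_ge0//.
apply: le_trans (cnorm_sum _ _ _) _.
have -> : n.+1%:R * M ^+ n = \sum_(i < n.+1) M ^+ n.
  by rewrite sumr_const card_ord mulr_natl.
apply: ler_sum => i _; have ni := leq_ord i.
have -> : M ^+ n = M ^+ (n.+1 - i.+1) * M ^+ i by rewrite -exprD; congr (_ ^+ _); lia.
rewrite cnormM !cnormX; apply: ler_pM; rewrite ?exprn_ge0 ?cnorm_ge0//.
  by apply: lerXn2r; rewrite ?nnegrE ?cnorm_ge0.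
by apply: lerXn2r; rewrite ?nnegrE ?cnorm_ge0.
Qed.

End Cexp.

(** * Locally uniform limits of polynomials *)

(* Since the libraries lack Cauchy's theorem, entire functions are handled as
   locally uniform limits of polynomials. *)
Definition polylim (R : realType) (g : R[i] -> R[i]) : Prop :=
  forall r e : R, 0 < e -> exists p : {poly R[i]},
    forall z, cnorm z <= r -> cnorm (g z - p.[z]) <= e.

Section Polylim.
Context (R : realType).
Local Notation N := (@cnorm R).
Implicit Types (f g : R[i] -> R[i]) (p q : {poly R[i]}) (z w a c : R[i]).

Lemma poly_bounded p (r : R) : exists2 M : R, 0 < M &
  forall z, N z <= r -> N p.[z] <= M.
Proof.
exists (1 + \sum_(i < size p) N p`_i * `|r| ^+ i).
  by rewrite ltr_pwDl// sumr_ge0// => i _; rewrite mulr_ge0 ?cnorm_ge0// exprn_ge0.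
move=> z hz; rewrite horner_coef; apply: le_trans (cnorm_sum _ _ _) _.
rewrite -[leLHS]add0r lerD// ler_sum// => i _.
rewrite cnormM cnormX ler_wpM2l ?cnorm_ge0// lerXn2r ?nnegrE ?cnorm_ge0//.
by rewrite (le_trans hz)// ler_norm.
Qed.

Lemma polylim_poly p : polylim (fun z => p.[z]).
Proof. by move=> r e e0; exists p => z _; rewrite subrr cnorm0 ltW. Qed.

Lemma polylim_id : polylim (@id R[i]).
Proof. by move=> r e e0; exists 'X => z _; rewrite hornerX subrr cnorm0 ltW. Qed.

Lemma polylim_cst c : polylim (fun=> c).
Proof. by move=> r e e0; exists c%:P => z _; rewrite hornerC subrr cnorm0 ltW. Qed.

Lemma polylim_bounded f (r : R) : polylim f -> exists2 M : R, 0 < M &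
  forall z, N z <= r -> N (f z) <= M.
Proof.
move=> /(_ r _ ltr01)[p hp]; have [M M0 hM] := poly_bounded p r.
exists (1 + M) => [|z hz]; first lra.
rewrite -[f z](subrK p.[z]); apply: le_trans (cnormD _ _) _.
by rewrite lerD ?hM ?hp.
Qed.

Lemma polylim_ball_lip f a (rho M : R) : polylim f -> 0 < rho ->
  (forall z, N (z - a) <= rho -> N (f z) <= M) ->
  forall z w, N (z - a) <= rho / 2 -> N (w - a) <= rho / 2 ->
  N (f z - f w) <= 8 * M / rho * N (z - w).
Proof.
move=> Ff rho0 H z w hz hw; apply/ler_addgt0Pr => e e0.
(* Replacing [f] by [p] at two points costs [2 * d], and the bound [M + d] on [p] costs the rest;
   the sum is exactly [e]. *)
set d := e / (2 + 8 / rho * N (z - w)).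
have k0 : 0 <= 8 / rho * N (z - w) by rewrite mulr_ge0 ?cnorm_ge0// divr_ge0// ltW.
have d0 : 0 < d by rewrite divr_gt0//; lra.
have ed : e = 2 * d + 8 / rho * N (z - w) * d.
  by rewrite -mulrDl /d mulrC divfK//; apply/eqP; lra.
have [p hp] := Ff (N a + rho) _ d0.
have near x : N (x - a) <= rho -> N (f x - p.[x]) <= d.
  by move=> hx; apply: hp; rewrite -[x](subrK a); apply: le_trans (cnormD _ _) _; lra.
have hM x : N (x - a) <= rho -> N p.[x] <= M + d.
  move=> hx; rewrite -[p.[x]](subrK (f x)); apply: le_trans (cnormD _ _) _.
  by rewrite addrC cnormB lerD ?near ?H.
have := poly_lip rho0 hM hz hw.
have -> : 8 * (M + d) / rho * N (z - w) =
    8 * M / rho * N (z - w) + 8 / rho * N (z - w) * d by ring.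
move=> h.
have nz : N (f z - p.[z]) <= d by apply: near; lra.
have nw : N (f w - p.[w]) <= d by apply: near; lra.
have -> : f z - f w = (f z - p.[z]) + (p.[z] - p.[w]) + (p.[w] - f w) by ring.
rewrite ed; have := cnormD (f z - p.[z] + (p.[z] - p.[w])) (p.[w] - f w).
have := cnormD (f z - p.[z]) (p.[z] - p.[w]).
by rewrite (cnormB p.[w]); lra.
Qed.

Lemma polylim_lip f (r : R) : polylim f -> exists2 L : R, 0 < L &
  forall z w, N z <= r -> N w <= r -> N (f z - f w) <= L * N (z - w).
Proof.
move=> Ff; have [r0|r0] := ltP 0 r; last first.
  exists 1 => // z w /le_trans/(_ r0)/cnorm_le0-> /le_trans/(_ r0)/cnorm_le0->.
  by rewrite !subrr cnorm0 mulr0.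
have [M M0 hM] := @polylim_bounded f (2 * r) Ff.
exists (8 * M / (2 * r)) => [|z w hz hw].
  by rewrite divr_gt0 ?mulr_gt0.
apply: (@polylim_ball_lip f 0) => //; rewrite ?subr0; try lra.
by move=> x; rewrite subr0; exact: hM.
Qed.

Lemma polylim_close f : (forall r e : R, 0 < e -> exists2 g, polylim g &
  forall z, N z <= r -> N (f z - g z) <= e) -> polylim f.
Proof.
move=> H r e e0; have [|g Gg hg] := H r (e / 2); first lra.
have [|p hp] := Gg r (e / 2); first lra.
exists p => z hz; apply: le_trans (cnormD3 _ (g z) _) _.
by have := hg _ hz; have := hp _ hz; lra.
Qed.

Lemma polylimD f g : polylim f -> polylim g -> polylim (fun z => f z + g z).
Proof.
move=> Ff Fg r e e0; have [|p hp] := Ff r (e / 2); first lra.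
have [|q hq] := Fg r (e / 2); first lra.
exists (p + q) => z hz; rewrite hornerD.
have -> : f z + g z - (p.[z] + q.[z]) = (f z - p.[z]) + (g z - q.[z]) by ring.
by apply: le_trans (cnormD _ _) _; have := hp _ hz; have := hq _ hz; lra.
Qed.

Lemma polylimM f g : polylim f -> polylim g -> polylim (fun z => f z * g z).
Proof.
move=> Ff Fg r e e0.
have [Mf Mf0 hMf] := @polylim_bounded f r Ff.
have [Mg Mg0 hMg] := @polylim_bounded g r Fg.
set d := Num.min 1 (e / (Mf + Mg + 1)).
have d0 : 0 < d by rewrite lt_min ltr01 divr_gt0//; lra.
have d1 : d <= 1 by rewrite ge_min lexx.
have de : d * (Mf + Mg + 1) <= e by rewrite -ler_pdivlMr ?ge_min ?lexx ?orbT//; lra.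
have [p hp] := Ff r _ d0; have [q hq] := Fg r _ d0.
exists (p * q) => z hz; rewrite hornerM.
have -> : f z * g z - p.[z] * q.[z] = f z * (g z - q.[z]) + (f z - p.[z]) * q.[z] by ring.
apply: le_trans (cnormD _ _) _; rewrite !cnormM.
have h1 : N (f z) * N (g z - q.[z]) <= Mf * d by apply: ler_pM; rewrite ?cnorm_ge0 ?hMf ?hq.
have h3 : N q.[z] <= Mg + 1.
  rewrite -[q.[z]](subrK (g z)); apply: le_trans (cnormD _ _) _.
  by rewrite cnormB; have := hq _ hz; have := hMg _ hz; lra.
have h2 : N (f z - p.[z]) * N q.[z] <= d * (Mg + 1) by apply: ler_pM; rewrite ?cnorm_ge0 ?hp.
nra.
Qed.

Lemma polylimN f : polylim f -> polylim (fun z => - f z).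
Proof.
move=> Ff; suff : polylim (fun z => -1 * f z).
  by congr polylim; apply/funext => z; rewrite mulN1r.
by apply: polylimM => //; exact: polylim_cst.
Qed.

Lemma polylimB f g : polylim f -> polylim g -> polylim (fun z => f z - g z).
Proof. by move=> Ff Fg; apply: polylimD => //; exact: polylimN. Qed.

Lemma polylimX f n : polylim f -> polylim (fun z => f z ^+ n).
Proof.
move=> Ff; elim: n => [|n IH]; first exact: polylim_cst.
suff : polylim (fun z => f z * f z ^+ n).
  by congr polylim; apply/funext => z; rewrite exprS.
exact: polylimM.
Qed.

Lemma polylim_comp f g : polylim g -> polylim f -> polylim (fun z => g (f z)).
Proof.
move=> Fg Ff r e e0.
have [Mf Mf0 hMf] := @polylim_bounded f r Ff.
have [|p hp] := Fg (Mf + 1) (e / 2); first lra.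
have [L L0 hL] := polylim_lip (Mf + 1) (polylim_poly p).
set d := Num.min 1 (e / (2 * L)).
have d0 : 0 < d by rewrite lt_min ltr01 divr_gt0//; lra.
have d1 : d <= 1 by rewrite ge_min lexx.
have de : d * (2 * L) <= e by rewrite -ler_pdivlMr ?ge_min ?lexx ?orbT//; lra.
have [q hq] := Ff r _ d0.
exists (p \Po q) => z hz; rewrite horner_comp.
have hf := hMf _ hz; have hqz := hq _ hz.
have hqM : N q.[z] <= Mf + 1.
  rewrite -[q.[z]](subrK (f z)); apply: le_trans (cnormD _ _) _.
  by rewrite cnormB; lra.
apply: le_trans (cnormD3 _ p.[f z] _) _.
have h1 : N (g (f z) - p.[f z]) <= e / 2 by apply: hp; lra.
have h2 : N (p.[f z] - p.[q.[z]]) <= L * N (f z - q.[z]) by apply: hL; lra.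
nra.
Qed.

(** Euler's limit with a rate: for [w = z / n.+1], both [cexp w] and [1 + w] are bounded by
    [expR (r / n.+1)] and differ by a quadratic term, and [cnormB_exp] compares their powers. *)
Lemma cexp_approx z (r : R) n : N z <= r -> 2 * r <= n.+1%:R ->
  N (cexp z - (1 + n.+1%:R^-1 * z) ^+ n.+1) <= 4 * r ^+ 2 * expR r / n.+1%:R.
Proof.
move=> hz hn; set m : R := n.+1%:R; have m0 : 0 < m by rewrite ltr0n.
have r0 := le_trans (cnorm_ge0 z) hz.
set w := n.+1%:R^-1 * z; have Nw : N w = N z / m.
  by rewrite cnormM cnormV cnorm_nat mulrC.
have hw : N w <= r / m by rewrite Nw ler_pM2r ?invr_gt0.
have hw2 : N w <= 1 / 2 by apply: le_trans hw _; rewrite ler_pdivrMr//; rewrite -/m in hn; lra.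
have -> : z = n.+1%:R * w.
  by rewrite mulrA divff ?mul1r// -cnorm_gt0 cnorm_nat.
rewrite cexpMn; have qw := cexp_quad hw2.
have m1 : N (cexp w) <= expR (r / m).
  by apply: le_trans (cnorm_cexp_le _) _; rewrite ler_expR.
have m2 : N (1 + w) <= expR (r / m).
  apply: le_trans (cnormD _ _) _; rewrite cnorm1.
  by apply: le_trans (expR_ge1Dx _); rewrite lerD2l.
apply: le_trans (cnormB_exp n m1 m2) _.
have -> : cexp w - (1 + w) = cexp w - 1 - w by ring.
have E1 : expR (r / m) ^+ n <= expR r.
  rewrite -expRM_natl ler_expR mulrA mulrAC ler_piMl// ler_pdivrMr// mul1r.
  by rewrite ler_nat.
have w2 : N w ^+ 2 <= (r / m) ^+ 2 by rewrite lerXn2r ?nnegrE ?cnorm_ge0// divr_ge0// ltW.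
have -> : 4 * r ^+ 2 * expR r / m = m * expR r * (4 * (r / m) ^+ 2) by field; lra.
apply: ler_pM; rewrite ?mulr_ge0 ?exprn_ge0 ?expR_ge0 ?cnorm_ge0 ?(ltW m0)//.
- by rewrite ler_pM2l.
- by apply: le_trans qw _; rewrite ler_pM2l.
Qed.

Lemma polylim_cexp : polylim (@cexp R).
Proof.
apply: polylim_close => r e e0.
set r' := `|r| + 1; have r0 : 0 < r' by rewrite ltr_wpDl.
set B := 2 * r' + 4 * r' ^+ 2 * expR r' / e.
have B0 : 0 <= 4 * r' ^+ 2 * expR r' / e.
  by rewrite (divr_ge0 _ (ltW e0))// mulr_ge0 ?expR_ge0// mulr_ge0 ?sqr_ge0.
have [n hn] : exists n : nat, B <= n.+1%:R.
  exists (Num.bound B); apply/ltW; apply: lt_le_trans (archi_boundP _) _.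
    by rewrite /B; lra.
  by rewrite ler_nat.
exists (fun z => (1 + n.+1%:R^-1 * z) ^+ n.+1).
  apply: polylimX; apply: polylimD; first exact: polylim_cst.
  by apply: polylimM; [exact: polylim_cst|exact: polylim_id].
move=> z hz; apply: le_trans (@cexp_approx z r' n _ _) _.
- by apply: le_trans hz _; have := ler_norm r; rewrite /r'; lra.
- by apply: le_trans hn; rewrite /B; lra.
rewrite ler_pdivrMr ?ltr0n// -ler_pdivrMl// mulrC.
by apply: le_trans hn; rewrite /B; lra.
Qed.

(** The derivatives at [a] of approximating polynomials form a Cauchy sequence, by [poly_deriv_le]
    applied to differences. The quadratic remainder of [poly_diff] then survives in the limit. *)
Lemma polylim_entire f : polylim f -> entire (f : Cplx R -> Cplx R).
Proof.
move=> Ff a.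
have [M M0 hM] := @polylim_bounded f (N a + 1) Ff.
have /choice[p hp] : forall n, exists p : {poly R[i]},
    forall z, N z <= N a + 1 -> N (f z - p.[z]) <= n.+1%:R^-1.
  by move=> n; apply: Ff; rewrite invr_gt0 ltr0n.
have ba z : N (z - a) <= 1 -> N z <= N a + 1.
  by move=> h; rewrite -[z](subrK a) addrC; apply: le_trans (cnormD _ _) _; rewrite lerD2l.
have inv_small (e : R) : 0 < e -> exists n0 : nat, forall n, (n0 <= n)%N -> n.+1%:R^-1 <= e.
  move=> e0; exists (Num.bound e^-1) => n hn.
  rewrite -[e]invrK lef_pV2 ?posrE ?invr_gt0 ?ltr0n//.
  apply/ltW; apply: lt_le_trans (archi_boundP _) _; first by rewrite invr_ge0 ltW.
  by rewrite ler_nat; apply: leq_trans hn _.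
have [|l hl] := @complex_cauchy_cvg R (fun n => (p n)^`().[a]).
  move=> e e0; have [|n0 hn0] := inv_small (e / 2); first lra.
  exists n0 => n hn; rewrite -hornerN -hornerD -derivB.
  apply: poly_deriv_le => z hz; rewrite hornerD hornerN.
  apply: le_trans (cnormD3 _ (f z) _) _; rewrite cnormB.
  have h1 := le_trans (hp n0 z (ba _ hz)) (hn0 _ (leqnn _)).
  have h2 := le_trans (hp n z (ba _ hz)) (hn0 _ hn).
  by lra.
have key z : N (z - a) <= 1 / 2 ->
    N (f z - f a - l * (z - a)) <= 2 * (M + 1) * N (z - a) ^+ 2.
  move=> hz; apply/ler_addgt0Pr => e e0.
  have [|n1 h1] := hl (e / 3); first lra.
  have [|n2 h2] := inv_small (e / 3); first lra.
  set n := maxn n1 n2.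
  have {}h1 := h1 n (leq_maxl _ _); have {}h2 := h2 n (leq_maxr _ _).
  have hz1 : N (z - a) <= 1 by lra.
  have ha : N (a - a) <= 1 by rewrite subrr cnorm0.
  have pz := le_trans (hp n z (ba _ hz1)) h2.
  have pa := le_trans (hp n a (ba _ ha)) h2.
  have pM x : N (x - a) <= 1 -> N (p n).[x] <= M + 1.
    move=> hx; rewrite -[(p n).[x]](subrK (f x)); apply: le_trans (cnormD _ _) _.
    rewrite addrC cnormB lerD// ?hM ?ba//.
    by apply: le_trans (hp n x (ba _ hx)) _; rewrite invf_le1 ?ltr0n// ler1n.
  have pd := poly_diff pM hz.
  have -> : f z - f a - l * (z - a) = (f z - (p n).[z]) + - (f a - (p n).[a]) +
     ((p n)^`().[a] - l) * (z - a) + ((p n).[z] - (p n).[a] - (p n)^`().[a] * (z - a)) by ring.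
  apply: le_trans (cnormD _ _) _; rewrite addrC lerD//.
  apply: le_trans (cnormD _ _) _; rewrite cnormM.
  have : N ((p n)^`().[a] - l) * N (z - a) <= e / 3 * 1 by apply: ler_pM; rewrite ?cnorm_ge0.
  have := cnormD (f z - (p n).[z]) (- (f a - (p n).[a])).
  by rewrite cnormN; lra.
apply/cvg_ex; exists (l : Cplx R); apply/cvgrPdist_le => e e0.
have [k ek] : exists k, e = k%:C by apply/complex_realP; rewrite gtr0_real.
have k0 : 0 < k by rewrite -ltcR -ek.
apply/(nbhs_cnormP (0 : Cplx R)); exists (Num.min (1 / 2) (k / (2 * (M + 1)))).
  by rewrite lt_min divr_gt0//= divr_gt0//; lra.
move=> h; rewrite subr0 lt_min => /andP[h1 h2] h0 /=.
have Nh : 0 < N h by rewrite cnorm_gt0.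
rewrite [_%:A]mulr1 cnormE ek lecR; rewrite ltr_pdivlMr in h2; last lra.
have := key (h + a); rewrite addrK => /(_ (ltW h1)) kh.
have e1 : l - h^-1 * (f (h + a) - f a) = - h^-1 * (f (h + a) - f a - l * h).
  by field.
rewrite [h^-1 *: _]/GRing.scale /= e1 cnormM cnormN cnormV mulrC ler_pdivrMr//.
by apply: le_trans kh _; nra.
Qed.

End Polylim.

(** * Peak polynomials, approximate inverses, gluing *)

Section Approximation.
Context (R : realType).
Local Notation N := (@cnorm R).
Implicit Types (f g h : R[i] -> R[i]) (p q : {poly R[i]}) (z w u v : R[i]).

Lemma exp_small (c e : R) : 0 <= c < 1 -> 0 < e -> exists n, c ^+ n <= e.
Proof.
move=> /andP[c0 c1] e0.
have c1' : `|c| < 1 by rewrite ger0_norm.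
have /cvgrPdist_le/(_ _ e0)[n _ hn] := cvg_expr c1'.
exists n; have := hn n (leqnn n); rewrite sub0r normrN ger0_norm//.
exact: exprn_ge0.
Qed.

Lemma closed_dist (K : set (Cplx R)) (u : Cplx R) : closed K -> ~ K u ->
  exists2 d : R, 0 < d & forall z, K z -> d <= N (z - u).
Proof.
move=> Kc Ku; have /open_cnormP/(_ u Ku)[d d0 hd] := closed_openC Kc.
by exists d => // z Kz; rewrite leNgt; apply/negP => /hd.
Qed.

(** For [c < 1] this certifies that [u] lies outside the polynomially convex hull of [K]. *)
Definition peaks_at (K : set (Cplx R)) (u : Cplx R) (c : R) :=
  exists p, p.[u] = 1 /\ forall z, K z -> N p.[z] <= c.

Lemma peaks_at_pow (K : set (Cplx R)) u (c e : R) : c < 1 -> 0 < e ->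
  peaks_at K u c -> peaks_at K u e.
Proof.
move=> c1 e0 [p [pu pK]].
(* The bound [c] may be negative when [K] is empty. *)
have [|n hn] := @exp_small (Num.max c 0) e _ e0.
  by rewrite le_max lexx orbT gt_max c1 ltr01.
exists (p ^+ n); split; first by rewrite horner_exp pu expr1n.
move=> z Kz; rewrite horner_exp cnormX; apply: le_trans hn.
by rewrite lerXn2r ?nnegrE ?cnorm_ge0 ?le_max ?lexx ?orbT// pK.
Qed.

(* If [p] peaks at [u] and [1 - p = ('X - u) * q], then [1 - ('X - v) * q]
   equals [1] at [v] and differs from [p] by [(v - u) * q], small on [K]. *)
Lemma peaks_at_push (K : set (Cplx R)) u v (d : R) : 0 < d ->
  (forall z, K z -> d <= N (z - u)) -> N (v - u) <= d / 3 ->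
  (forall e : R, 0 < e -> peaks_at K u e) -> peaks_at K v (2 / 3).
Proof.
move=> d0 hd vu /(_ (1 / 4)) [|p [pu pK]]; first lra.
have /factor_theorem[q hq] : root (1 - p) u.
  by rewrite /root hornerD hornerN hornerC pu subrr.
exists (1 - q * ('X - v%:P)); split.
  by rewrite hornerD hornerN hornerM hornerXsubC subrr mulr0 subr0 hornerC.
move=> z Kz; have := congr1 (horner^~ z) hq.
rewrite hornerD hornerN hornerC hornerM hornerXsubC => hz.
rewrite hornerD hornerN hornerC hornerM hornerXsubC.
have -> : 1 - q.[z] * (z - v) = p.[z] + q.[z] * (v - u).
  have -> : p.[z] = 1 - (1 - p.[z]) by ring.
  by rewrite hz; ring.
apply: le_trans (cnormD _ _) _; rewrite cnormM.
have h1 : N q.[z] * N (z - u) <= 5 / 4.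
  rewrite -cnormM -hz; apply: le_trans (cnormBD _ _) _.
  by rewrite cnorm1; have := pK _ Kz; lra.
have h2 : N q.[z] * N (v - u) <= N q.[z] * (N (z - u) / 3).
  by rewrite ler_wpM2l ?cnorm_ge0//; apply: le_trans vu _; have := hd _ Kz; lra.
by have := pK _ Kz; lra.
Qed.

(** The points outside [K] that admit a peak form a nonempty, relatively open and relatively closed
    subset of the connected complement. Far from [K] a multiple of ['X] peaks; openness and
    closedness both come from [peaks_at_push], whose admissible displacement depends only on the
    distance to [K]. *)
Lemma peak_function (K : set (Cplx R)) (B : R) u (e : R) :
  closed K -> (forall z, K z -> N z <= B) -> connected (~` K) -> ~ K u -> 0 < e ->
  peaks_at K u e.
Proof.
move=> Kc KB Kcon Ku e0.
pose W := [set v | ~ K v /\ peaks_at K v (2 / 3)].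
have W_peak v (c : R) : W v -> 0 < c -> peaks_at K v c.
  by move=> [_ pv] c0; apply: peaks_at_pow pv => //; lra.
have WE : W = ~` K.
  apply: Kcon.
  - pose b := 2 * (`|B| + 1); have b0 : 0 < b by rewrite mulr_gt0// ltr_wpDl.
    have far z : K z -> N z <= b / 2.
      by move=> /KB h; have := ler_norm B; rewrite /b; lra.
    exists b%:C; split.
      by move=> /far; rewrite cnorm_realp ?(ltW b0)//; lra.
    apply: (@peaks_at_pow _ _ (1 / 2)); [lra|lra|].
    exists (b^-1%:C *: 'X); split.
      by rewrite hornerZ hornerX -rmorphM mulVf ?rmorph1// gt_eqF.
    move=> z /far hz; rewrite hornerZ hornerX cnormM cnorm_realp ?invr_ge0 ?(ltW b0)//.
    by rewrite ler_pdivrMl//; lra.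
  - exists W; last by apply/seteqP; split => [v [? ?]|v [? []]].
    apply/open_cnormP => v Wv; have [Kv _] := Wv.
    have [d d0 hd] := closed_dist Kc Kv.
    exists (d / 3) => [|w hw]; first lra.
    split; first by move=> /hd; rewrite leNgt (lt_trans hw)//; lra.
    apply: (peaks_at_push d0 hd (ltW hw)) => c c0; exact: W_peak.
  - exists (closure W); first exact: closed_closure.
    apply/seteqP; split => v.
      by move=> Wv; split; [case: Wv|exact: subset_closure].
    move=> [Kv /closure_cnormP Wv]; split => //.
    have [d d0 hd] := closed_dist Kc Kv.
    have [|w Ww hw] := Wv (d / 4); first lra.
    (* As [w] is within [d / 4] of [v], it keeps distance [3 / 4 * d] from [K], and [d / 4] is
       exactly a third of that. *)
    apply: (@peaks_at_push K w v (3 / 4 * d)); first lra.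
    + move=> z /hd h; have := cnormD3 z w v; lra.
    + by rewrite cnormB; lra.
    + by move=> c c0; apply: W_peak.
by apply: W_peak => //; rewrite WE.
Qed.

(** The bound [d / 32] on the disc of radius [d] is what makes the Cauchy constant
    [8 * (d / 32) / d] equal to [1 / 4]. *)
Lemma near_id_lip (S : set R[i]) (d : R) f (k x y : R[i]) : 0 < d -> polylim f ->
  (forall k x : R[i], S k -> N (x - k) <= d -> N (f x - x) <= d / 32) ->
  S k -> N (x - k) <= d / 2 -> N (y - k) <= d / 2 ->
  N ((f x - x) - (f y - y)) <= 1 / 4 * N (x - y).
Proof.
move=> d0 Ff near_id Sk hx hy.
have -> : 1 / 4 = 8 * (d / 32) / d by field; lra.
have Fi : polylim (fun z => f z - z) by apply: polylimB => //; exact: polylim_id.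
by apply: (polylim_ball_lip Fi d0 _ hx hy) => z; exact: near_id.
Qed.

(** Equal images force [x] and [y] within [d / 16] of each other, inside the range of [near_id_lip].
    There [J o G - id] changes by exactly [y - x] in modulus, although it is [1 / 4]-Lipschitz. *)
Lemma near_id_inj (S : set R[i]) (d : R) (G J : R[i] -> R[i]) : 0 < d ->
  polylim (J \o G) ->
  (forall k x : R[i], S k -> N (x - k) <= d -> N (J (G x) - x) <= d / 32) ->
  set_inj S G.
Proof.
move=> d0 FJG near_id x y /set_mem Sx /set_mem Sy exy.
have hx : N (J (G x) - x) <= d / 32 by apply: (near_id x) => //; rewrite subrr cnorm0 ltW.
have hy : N (J (G y) - y) <= d / 32 by apply: (near_id y) => //; rewrite subrr cnorm0 ltW.
have hxy : N (y - x) <= d / 16.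
  by apply: le_trans (cnormD3 _ (J (G y)) _) _; rewrite -{2}exy (cnormB y); lra.
have := @near_id_lip S d _ x x y d0 FJG near_id Sx; rewrite subrr cnorm0 /= exy.
have -> : J (G y) - x - (J (G y) - y) = y - x by ring.
rewrite (cnormB x) => h; have {}h : N (y - x) <= 1 / 4 * N (y - x) by apply: h; lra.
by apply/esym/eqP; rewrite -subr_eq0; apply/eqP/cnorm_le0; lra.
Qed.

(* The iteration [x_(j+1) = y - psi (x_j)] with [psi = J o G - id] a contraction;
   every iterate is an entire function of [y]. *)
Lemma near_id_inverse (S : set R[i]) (d e : R) (G J : R[i] -> R[i]) : 0 < d ->
  polylim G -> polylim J ->
  (forall k x : R[i], S k -> N (x - k) <= d -> N (J (G x) - x) <= d / 32) ->
  0 < e -> exists2 J', polylim J' &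
  forall k x : R[i], S k -> N (x - k) <= d / 4 -> N (J' (G x) - x) <= e.
Proof.
move=> d0 FG FJ near_id e0; pose psi x := J (G x) - x.
have Fpsi : polylim psi by apply: polylimB; [exact: polylim_comp|exact: polylim_id].
pose X := fix X j y := if j is j'.+1 then y - psi (X j' y) else y.
have FX j : polylim (X j).
  elim: j => [|j IH]; first exact: polylim_id.
  by apply: polylimB; [exact: polylim_id|exact: (polylim_comp Fpsi)].
have hX j (k x : R[i]) : S k -> N (x - k) <= d / 4 ->
    N (X j (J (G x)) - x) <= d / 32 * (1 / 4) ^+ j.
  move=> Sk hx; elim: j => [|j IH].
    by rewrite expr0 mulr1; apply: (near_id k) => //; lra.
  have -> : X j.+1 (J (G x)) - x = psi x - psi (X j (J (G x))).
    by rewrite /= /psi; ring.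
  have q1 : (1 / 4 : R) ^+ j <= 1 by rewrite exprn_ile1//; lra.
  have q2 : d / 32 * (1 / 4) ^+ j <= d / 32 by rewrite ler_piMr//; lra.
  apply: le_trans (near_id_lip (f := J \o G) (y := X j (J (G x))) d0 _ near_id Sk _ _) _.
  - exact: polylim_comp.
  - lra.
  - by apply: le_trans (cnormD3 _ x _) _; lra.
  - by rewrite cnormB exprS; lra.
have [||j hj] := @exp_small (1 / 4) (e / (d / 32)).
- by apply/andP; split; lra.
- by rewrite divr_gt0//; lra.
exists (fun y => X j (J y)); first exact: polylim_comp.
move=> k x Sk hx; apply: le_trans (hX j k x Sk hx) _.
by rewrite -ler_pdivlMl ?divr_gt0// [leRHS]mulrC.
Qed.

(** Both [0] and [1] are fixed points with vanishing derivative, exchanged by the symmetry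
    [z -> 1 - z]. *)
Let smoothstep z : R[i] := 3 * z ^+ 2 - 2 * z ^+ 3.

Let iter_smoothstep0 k z : N z <= 1 / 4 ->
  N (iter k smoothstep z) <= (7 / 8) ^+ k * (1 / 4).
Proof.
move=> hz; elim: k => [|k IH]; first by rewrite expr0 mul1r.
rewrite iterS; set t := iter k _ z in IH *.
have q1 : (7 / 8 : R) ^+ k <= 1 by rewrite exprn_ile1//; lra.
have -> : smoothstep t = t * (3 * t - 2 * t ^+ 2) by rewrite /smoothstep; ring.
have t0 := cnorm_ge0 t.
have h : N (3 * t - 2 * t ^+ 2) <= 7 / 8.
  apply: le_trans (cnormBD _ _) _; rewrite !cnormM !cnorm_nat.
  have t1 : N t <= 1 / 4 by lra.
  by nra.
have -> : (7 / 8) ^+ k.+1 * (1 / 4) = (7 / 8) ^+ k * (1 / 4) * (7 / 8) :> R by rewrite exprS; ring.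
rewrite cnormM; apply: ler_pM; rewrite ?cnorm_ge0//.
Qed.

Let iter_smoothstep1 k z : N (z - 1) <= 1 / 4 ->
  N (iter k smoothstep z - 1) <= (7 / 8) ^+ k * (1 / 4).
Proof.
have s1 t : smoothstep (1 - t) = 1 - smoothstep t by rewrite /smoothstep; ring.
have -> : iter k smoothstep z = 1 - iter k smoothstep (1 - z).
  elim: k => [|k IH]; first by rewrite /=; ring.
  by rewrite !iterS IH s1.
rewrite addrAC subrr add0r cnormN cnormB; exact: iter_smoothstep0.
Qed.

(** Division by [a] carries the two discs to the discs of radius [1 / 4] about [0] and [1], where
    the iterated [smoothstep] is close to [0] and to [1]; it serves as an entire cutoff between [h]
    and [g]. *)
Lemma polylim_glue h g (a : R[i]) (e : R) : polylim h -> polylim g -> a != 0 -> 0 < e ->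
  exists h', [/\ polylim h',
    forall z, N z <= N a / 4 -> N (h' z - h z) <= e &
    forall z, N (z - a) <= N a / 4 -> N (h' z - g z) <= e].
Proof.
move=> Fh Fg a0 e0; have Na : 0 < N a by rewrite cnorm_gt0.
have [M M0 hM] := polylim_bounded (2 * N a) (polylimB Fg Fh).
have [||k hk] := @exp_small (7 / 8) (e / M) _ _; first by apply/andP; split; lra.
  by rewrite divr_gt0.
pose chi z := iter k smoothstep (z / a).
have Fchi : polylim chi.
  rewrite /chi; elim: k {hk chi} => [|k IH].
    by apply: polylimM; [exact: polylim_id|exact: polylim_cst].
  have Fs : polylim smoothstep.
    have FX n : polylim (fun z : R[i] => z ^+ n).
      exact: polylimX (@polylim_id R).
    exact: (polylimB (polylimM (polylim_cst 3) (FX 2)) (polylimM (polylim_cst 2) (FX 3))).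
  exact: (polylim_comp Fs IH).
have kM : (7 / 8) ^+ k * (1 / 4) * M <= e.
  have : (7 / 8) ^+ k * M <= e by rewrite -ler_pdivlMr.
  have : 0 <= (7 / 8) ^+ k * M by rewrite mulr_ge0 ?exprn_ge0//; lra.
  lra.
exists (fun z => h z + chi z * (g z - h z)); split.
- by apply: polylimD => //; apply: polylimM => //; exact: polylimB.
- move=> z hz; rewrite addrAC subrr add0r cnormM; apply: le_trans kM.
  apply: ler_pM; rewrite ?cnorm_ge0//; last by apply: hM; lra.
  by apply: iter_smoothstep0; rewrite cnormM cnormV ler_pdivrMr//; lra.
- move=> z hz; have -> : h z + chi z * (g z - h z) - g z = (chi z - 1) * (g z - h z) by ring.
  rewrite cnormM; apply: le_trans kM.
  apply: ler_pM; rewrite ?cnorm_ge0//; last first.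
    by apply: hM; rewrite -[z](subrK a); apply: le_trans (cnormD _ _) _; lra.
  apply: iter_smoothstep1; have -> : z / a - 1 = (z - a) / a by field.
  by rewrite cnormM cnormV ler_pdivrMr//; lra.
Qed.

End Approximation.

(** * Orbits *)

Section Orbits.
Context (R : realType).
Local Notation N := (@cnorm R).
Implicit Types (f g h : R[i] -> R[i]) (z w u v x y : R[i]) (n j : nat).

Definition orb h n x : R[i] := iter n (fun w => cexp (h w)) x.

Lemma orbS h n x : orb h n.+1 x = cexp (h (orb h n x)).
Proof. exact: iterS. Qed.

Lemma polylim_orb h n : polylim h -> polylim (orb h n).
Proof.
move=> Fh; elim: n => [|n IH]; first exact: polylim_id.
exact: (polylim_comp (@polylim_cexp R) (polylim_comp Fh IH)).
Qed.

(** Continuous dependence of finite orbits on the function, with a tolerance [t] independent of the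
    starting point. The margin [1] keeps the perturbed orbit in the disc of radius [r], the only
    place where [h'] is controlled. *)
Lemma orb_close h (r e : R) n : polylim h -> 0 < e ->
  exists2 t : R, 0 < t & forall h' x, (forall z, N z <= r -> N (h' z - h z) <= t) ->
    (forall j, (j < n)%N -> N (orb h j x) + 1 <= r) ->
    (forall j, (j <= n)%N -> N (orb h' j x - orb h j x) <= e) /\
    (forall j, (j < n)%N -> N (h' (orb h' j x) - h (orb h j x)) <= e).
Proof.
move=> Fh; elim: n e => [|n IH] e e0.
  exists 1 => // h' x _ _; split => // j; rewrite leqn0 => /eqP->.
  by rewrite /= subrr cnorm0 ltW.
have [L L0 hL] := polylim_lip r Fh.
have [M M0 hM] := polylim_bounded r Fh.
have [E E0 hE] := polylim_lip (M + 1) (@polylim_cexp R).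
pose d := Num.min (Num.min 1 e) (e / E).
have d0 : 0 < d by rewrite !lt_min ltr01 e0 divr_gt0.
have d1 : d <= 1 by rewrite !ge_min lexx.
have de : d <= e by rewrite !ge_min lexx orbT.
have dE : E * d <= e by rewrite mulrC -ler_pdivlMr ?ge_min ?lexx ?orbT.
pose e' := Num.min d (d / (2 * L)).
have e'0 : 0 < e' by rewrite lt_min d0 divr_gt0 ?mulr_gt0.
have e'd : e' <= d by rewrite ge_min lexx.
have e'L : L * e' <= d / 2.
  have : e' * (2 * L) <= d by rewrite -ler_pdivlMr ?mulr_gt0// ge_min lexx orbT.
  lra.
have [t t0 ht] := IH _ e'0.
exists (Num.min t (d / 2)); first by rewrite lt_min t0 divr_gt0.
move=> h' x hh' hx.
have [||h1 h2] := ht h' x.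
- by move=> z /hh' h3; apply: le_trans h3 _; rewrite ge_min lexx.
- by move=> j jn; apply: hx; exact: leqW.
have xn := hx n (ltnSn n).
have cn := h1 n (leqnn n).
have xn' : N (orb h' n x) <= r.
  by have := cnormB_ge (orb h' n x) (orb h n x); lra.
have key : N (h' (orb h' n x) - h (orb h n x)) <= d.
  apply: le_trans (cnormD3 _ (h (orb h' n x)) _) _.
  have k1 : N (h' (orb h' n x) - h (orb h' n x)) <= d / 2.
    by apply: le_trans (hh' _ xn') _; rewrite ge_min lexx orbT.
  have k2 := hL (orb h' n x) (orb h n x) xn'.
  have k3 : N (h (orb h' n x) - h (orb h n x)) <= L * N (orb h' n x - orb h n x).
    by apply: k2; lra.
  have k4 : L * N (orb h' n x - orb h n x) <= L * e' by rewrite ler_pM2l.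
  lra.
split=> j; last first.
  rewrite ltnS leq_eqVlt => /predU1P[->|/h2 h3]; first by lra.
  lra.
rewrite leq_eqVlt => /predU1P[->|]; last by rewrite ltnS => /h1; lra.
rewrite !orbS; have hMn : N (h (orb h n x)) <= M by apply: hM; lra.
have hMn' := cnormB_ge (h' (orb h' n x)) (h (orb h n x)).
apply: le_trans (hE _ _ _ _) _; [lra|lra|].
by apply: le_trans dE; rewrite ler_pM2l.
Qed.

(** * Centres and radii of the discs that the orbit of the compact set visits *)

Section Constants.
Context (B : R).

(* [ctr n] is the target of [h] on the [n]-th image of [K], whose centre and
   radius are [cen n] and [rad n]; [h] no longer changes on the disc of radius
   [frozen n] up to the tolerance of stage [n], and this disc is empty at stage 0. *)
Definition ctr n : R := 4 * (B + 2) + 8 * n%:R.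
Definition cen n : R[i] := if n is j.+1 then (expR (ctr j))%:C else 0.
Definition rad n : R := if n is j.+1 then expR (ctr j) / 4 else B + 1.
Definition frozen n : R := if n is j.+1 then expR (ctr j) / 4 else -1.

Lemma ctr_ge0 n : 0 <= B -> 0 <= ctr n.
Proof. by move=> B0; have := ler0n R n; rewrite /ctr; lra. Qed.

Lemma expR_ctr_ge n : 0 <= B -> 4 * (B + 2) + 1 + 8 * n%:R <= expR (ctr n).
Proof. by move=> B0; have := expR_ge1Dx (ctr n); rewrite /ctr; lra. Qed.

Lemma expR_ctrS n : 0 <= B -> 9 * expR (ctr n) <= expR (ctr n.+1).
Proof.
move=> B0; have -> : ctr n.+1 = 8 + ctr n by rewrite /ctr -nat1r; ring.
rewrite (expRD 8) ler_wpM2r ?expR_ge0//; have := expR_ge1Dx (8 : R); lra.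
Qed.

Lemma expR_ctr_le i j : 0 <= B -> (i <= j)%N -> expR (ctr i) <= expR (ctr j).
Proof. by move=> B0 ij; rewrite ler_expR lerD2l ler_pM2l ?ler_nat. Qed.

(** This dictates the constants in [ctr]. The summand [4 * (B + 2)] puts the initial disc and a
    margin [1] inside the first frozen disc. The increment [8] multiplies [expR (ctr j)] by at least
    9, so a quarter of the next value exceeds [5 / 4] of the present one by at least [1]. *)
Lemma cen_rad_frozen j n : 0 <= B -> (j < n)%N -> N (cen j) + rad j + 1 <= frozen n.
Proof.
case: n => // n B0; rewrite ltnS; case: j => [|j] jn.
  have h := expR_ctr_ge 0 B0; have := expR_ctr_le B0 jn.
  by rewrite /cen cnorm0 /rad /frozen; lra.
have h := expR_ctr_le B0 jn; have h1 := expR_ctrS j B0.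
have h2 := expR_ctr_ge j B0; have := ler0n R j.
by rewrite /cen cnorm_realp ?expR_ge0// /rad /frozen; lra.
Qed.

Lemma frozen_ge n : 0 <= B -> n%:R <= frozen n.+1.
Proof. by move=> B0; have := expR_ctr_ge n B0; have := ler0n R n; rewrite /frozen; lra. Qed.

Lemma rad_ge n : 0 <= B -> 1 <= rad n.
Proof.
move=> B0; case: n => [|n]; first by rewrite /rad; lra.
by have := expR_ctr_ge n B0; have := ler0n R n; rewrite /rad; lra.
Qed.

Lemma glue_at n h g (e : R) : polylim h -> polylim g -> 0 < e ->
  exists h', [/\ polylim h',
    forall z, N z <= frozen n -> N (h' z - h z) <= e &
    forall z, N (z - cen n) <= rad n -> N (h' z - g z) <= e].
Proof.
move=> Fh Fg e0; case: n => [|n].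
  exists g; split => // z; last by move=> _; rewrite subrr cnorm0 ltW.
  by rewrite /frozen => h1; have := cnorm_ge0 z; lra.
have Na : N (cen n.+1) = expR (ctr n) by rewrite /cen cnorm_realp ?expR_ge0.
have a0 : cen n.+1 != 0 by rewrite -cnorm_gt0 Na expR_gt0.
by have := polylim_glue Fh Fg a0 e0; rewrite Na.
Qed.

Lemma cexp_near_ctr n v : N (v - (ctr n)%:C) <= 1 / 8 ->
  N (cexp v - cen n.+1) <= rad n.+1 * (8 * N (v - (ctr n)%:C)).
Proof.
move=> h; rewrite -{1}(subrK (ctr n)%:C v) cexpD cexp_real.
have -> : cexp (v - (ctr n)%:C) * (expR (ctr n))%:C - cen n.+1 =
    (expR (ctr n))%:C * (cexp (v - (ctr n)%:C) - 1) by rewrite /cen; ring.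
rewrite cnormM cnorm_realp ?expR_ge0// /rad.
have := cexp_sub1 h; have := expR_ge0 (ctr n); nra.
Qed.

Definition tame h n x := forall j, (j <= n)%N -> N (orb h j x - cen j) <= rad j.

Lemma tame_frozen h n m x : 0 <= B -> tame h m x -> (n <= m.+1)%N ->
  forall j, (j < n)%N -> N (orb h j x) + 1 <= frozen n.
Proof.
move=> B0 ht nm j jn; have hj : (j <= m)%N by rewrite -ltnS (leq_trans jn).
have h1 := ht _ hj; have := cen_rad_frozen B0 jn.
by have := cnormB_ge (orb h j x) (cen j); lra.
Qed.

End Constants.

End Orbits.

(** * The inductive step *)

Section Step.
Context (R : realType).
Local Notation N := (@cnorm R).
Implicit Types (f g h : R[i] -> R[i]) (z w u v x y k : R[i]) (n j : nat).

Definition meets_frontier (K : set (Cplx R)) (q : R[i]) (s : R) :=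
  exists p, [/\ K p, closure (~` K) p & N (p - q) < s].

(** A polynomial peaking at a point [u] just outside [K] is composed with an approximate left
    inverse of [G], which makes it a function of [G x]. Normalising to exactly [1] at [G u] allows
    high powers to be taken without losing the peak. *)
Lemma peak_pullback (K : set (Cplx R)) (B d s : R) (q0 : R[i]) (G J : R[i] -> R[i]) :
  closed K -> (forall z, K z -> N z <= B) -> connected (~` K) ->
  0 < d -> polylim G -> polylim J ->
  (forall k x : R[i], K k -> N (x - k) <= d -> N (J (G x) - x) <= d / 32) ->
  exists (q : R[i] -> R[i]) (d2 : R), [/\ polylim q, 0 < d2 <= d / 4,
    forall k x : R[i], K k -> N (x - k) <= d2 -> N (q (G x)) <= 1 / 2 &
    meets_frontier K q0 s -> exists u k : R[i],
      [/\ N (u - q0) < s, K k, N (u - k) <= d / 4 & q (G u) = 1]].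
Proof.
move=> Kc KB Kcon d0 FG FJ near_id.
have [[p [Kp /closure_cnormP Cp ps]]|Hno] := pselect (meets_frontier K q0 s); last first.
  exists (fun=> 0), (d / 4); split; [exact: polylim_cst|by apply/andP; split; lra| |by []].
  by move=> k x _ _; rewrite cnorm0; lra.
have [|u Ku up] := Cp (Num.min (d / 4) (s - N (p - q0))).
  by rewrite lt_min divr_gt0//= subr_gt0.
move: up; rewrite lt_min => /andP[up1 up2].
have [P [Pu PK]] : peaks_at K u (1 / 8).
  by apply: (peak_function (B := B)) => //; lra.
have [L L0 hL] := polylim_lip (`|B| + d + 1) (polylim_poly P).
have bK k : K k -> N k <= `|B| by move=> /KB h; apply: le_trans h (ler_norm _).
pose e := Num.min 1 (1 / (8 * L)).
have e0 : 0 < e by rewrite lt_min ltr01 divr_gt0 ?mulr_gt0.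
have e1 : e <= 1 by rewrite ge_min lexx.
have eL : L * e <= 1 / 8.
  have : e * (8 * L) <= 1 by rewrite -ler_pdivlMr ?mulr_gt0// ge_min lexx orbT.
  lra.
have [J' FJ' hJ'] := near_id_inverse d0 FG FJ near_id e0.
have close k x : K k -> N (x - k) <= d / 4 -> N (P.[J' (G x)] - P.[x]) <= 1 / 8.
  move=> Kk hx; have h := hJ' _ _ Kk hx.
  have x1 : N x <= `|B| + d.
    by rewrite -[x](subrK k); apply: le_trans (cnormD _ _) _; have := bK _ Kk; lra.
  have x2 := cnormB_ge (J' (G x)) x.
  apply: le_trans (hL _ _ _ _) _; [lra|lra|].
  by apply: le_trans eL; rewrite ler_pM2l.
have upd : N (u - p) <= d / 4 by lra.
set b := P.[J' (G u)].
have b1 : N (b - 1) <= 1 / 8 by rewrite -Pu; exact: close upd.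
have b2 : 7 / 8 <= N b.
  have := cnormB_ge 1 (1 - b); have -> : 1 - (1 - b) = b by ring.
  by rewrite cnorm1 (cnormB 1); lra.
have b0 : b != 0 by rewrite -cnorm_gt0; lra.
pose d2 := Num.min (d / 4) (1 / (8 * L)).
have d20 : 0 < d2 by rewrite lt_min !divr_gt0 ?mulr_gt0.
have d2d : d2 <= d / 4 by rewrite ge_min lexx.
have d2L : L * d2 <= 1 / 8.
  have : d2 * (8 * L) <= 1 by rewrite -ler_pdivlMr ?mulr_gt0// ge_min lexx orbT.
  lra.
(* Near [K] the numerator is at most [3 / 8]: an eighth each for the inverse, for moving [x] to [k],
   and for [P] on [K]. This is less than half of [N b >= 7 / 8]. *)
exists (fun y => b^-1 * P.[J' y]), d2; split.
- by apply: polylimM; [exact: polylim_cst|exact: (polylim_comp (polylim_poly P))].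
- by apply/andP.
- move=> k x Kk hx.
  have c1 : N (P.[J' (G x)] - P.[x]) <= 1 / 8 by apply: (close k) => //; lra.
  have kB := bK _ Kk.
  have x1 : N x <= `|B| + d + 1.
    by rewrite -[x](subrK k); apply: le_trans (cnormD _ _) _; lra.
  have c2 : N (P.[x] - P.[k]) <= 1 / 8.
    apply: le_trans (hL _ _ _ _) _; [lra|lra|].
    by apply: le_trans d2L; rewrite ler_pM2l.
  have c3 := PK _ Kk.
  rewrite cnormM cnormV ler_pdivrMl ?cnorm_gt0//.
  have -> : P.[J' (G x)] = (P.[J' (G x)] - P.[x]) + (P.[x] - P.[k]) + P.[k] by ring.
  have := cnormD (P.[J' (G x)] - P.[x] + (P.[x] - P.[k])) P.[k].
  have := cnormD (P.[J' (G x)] - P.[x]) (P.[x] - P.[k]).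
  lra.
- move=> _; exists u, p; split => //; last by rewrite /= mulVf.
  by have := cnormD3 u p q0; lra.
Qed.

(** By [cexp_near_ctr], an error below [1 / 16] before exponentiation places the image within half
    the radius of its disc; since [rad] is at least [1], the room left is at least [1 / 2]. *)
Lemma orb_cen (B b : R) h n x : 0 <= B -> b < 1 / 16 -> N x <= B + 1 / 2 ->
  (forall j, (j < n)%N -> N (h (orb h j x) - (ctr B j)%:C) <= b) ->
  forall j, (j <= n)%N -> N (orb h j x - cen B j) + 1 / 2 <= rad B j.
Proof.
move=> B0 b1 hx H [|j] jn; first by rewrite /cen /rad subr0 /=; lra.
have hj := H _ jn; rewrite orbS.
have h8 : N (h (orb h j x) - (ctr B j)%:C) <= 1 / 8 by lra.
have := cexp_near_ctr h8; have := rad_ge j.+1 B0.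
set r := rad B j.+1; set t := N (h _ - _) in hj h8 *; nra.
Qed.

(** The conditions are imposed on a neighbourhood of [K] because Cauchy estimates need room. The
    bounds [b < 1 / 16] and [d / 64], half of what [near_id_inj] requires, leave a margin for
    perturbing [h]; [d <= 1 / 2] keeps the neighbourhood inside the initial disc. *)
Definition good (K : set R[i]) (B : R) n h := polylim h /\
  exists (d b : R) (J : R[i] -> R[i]), [/\ 0 < d <= 1 / 2, b < 1 / 16, polylim J &
  forall k x, K k -> N (x - k) <= d ->
    (forall j, (j < n)%N -> N (h (orb h j x) - (ctr B j)%:C) <= b) /\
    N (J (orb h n x) - x) <= d / 64].

(* Near the current image of [K], of centre [a], the new
   function is [c + l (w - a) - c q^m] up to a small error, which after [cexp]
   still has an approximate inverse on a neighbourhood of [K] since [l] is small,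
   while the peak [q = 1] brings the orbit of [u] back near the origin. *)
Lemma good_step (K : set (Cplx R)) (B t s : R) (q0 : R[i]) n h :
  closed K -> 0 <= B -> (forall z, K z -> N z <= B) -> connected (~` K) ->
  0 < t -> good K B n h -> exists h', [/\ good K B n.+1 h',
    forall z, N z <= frozen B n -> N (h' z - h z) <= t &
    meets_frontier K q0 s -> exists u, [/\ N (u - q0) < s,
      tame B h' n u & N (h' (orb h' n u)) <= 1]].
Proof.
move=> Kc B0 KB Kcon t0 [Fh [d [b [J [/andP[d0 dh] b16 FJ H]]]]].
have FG := polylim_orb n Fh.
have near32 k x : K k -> N (x - k) <= d -> N (J (orb h n x) - x) <= d / 32.
  by move=> Kk /(H _ _ Kk)[_]; lra.
have hcen k x : K k -> N (x - k) <= d ->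
    forall j, (j <= n)%N -> N (orb h j x - cen B j) + 1 / 2 <= rad B j.
  move=> Kk hx; have [h1 _] := H _ _ Kk hx; apply: (orb_cen B0 b16) => //.
  by rewrite -[x](subrK k); apply: le_trans (cnormD _ _) _; have := KB _ Kk; lra.
have [q [d2 [Fq /andP[d20 d2d] qK qu]]] :=
  @peak_pullback K B d s q0 _ _ Kc KB Kcon d0 FG FJ near32.
(* A sharper left inverse: its error [d2 / 128], and an equal one from its Lipschitz bound, add up
   to the [d2 / 64] that [good] demands. *)
have [|J1 FJ1 hJ1] := near_id_inverse (e := d2 / 128) d0 FG FJ near32; first lra.
set a := cen B n; set rd := rad B n; have rd1 : 1 <= rd := rad_ge n B0.
have [L L0 hL] := polylim_lip (N a + rd + 1) FJ1.
pose rho := Num.min (1 / 8) (d2 / (128 * L)).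
have rho0 : 0 < rho by rewrite lt_min !divr_gt0 ?mulr_gt0.
have rho8 : rho <= 1 / 8 by rewrite ge_min lexx.
have rhoL : L * rho <= d2 / 128.
  have : rho * (128 * L) <= d2 by rewrite -ler_pdivlMr ?mulr_gt0// ge_min lexx orbT.
  lra.
(* The slope is chosen so that the quadratic error of [cexp] on arguments of size [2 * (l * rd)],
   once divided by [l], is [rho / 2]. *)
pose l := rho / (32 * rd ^+ 2).
have rd2 : 1 <= rd ^+ 2 by rewrite expr2; nra.
have l0 : 0 < l by rewrite divr_gt0//; lra.
have lrd : l * (32 * rd ^+ 2) = rho by rewrite divfK// gt_eqF//; lra.
have lrd1 : l * rd <= 1 / 256 by nra.
(* Three errors [eta], divided by [l], amount to [rho / 4]; with the quadratic error the total stays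
   below [rho]. *)
pose eta := l * rho / 12.
have eta0 : 0 < eta by rewrite divr_gt0// mulr_gt0.
have etal : 12 * eta = l * rho by rewrite mulrC divfK.
set c := ctr B n; have c0 : 0 <= c := ctr_ge0 n B0.
(* The power [m] makes the peak term negligible near [K], while at [u] it remains equal to [c]. *)
have [||m hm] := @exp_small R (1 / 2) (eta / (c + 1)).
- by apply/andP; split; lra.
- by rewrite divr_gt0//; lra.
have {}hm : c * (1 / 2) ^+ m <= eta.
  have h1 : (1 / 2) ^+ m * (c + 1) <= eta by rewrite -ler_pdivlMr//; lra.
  have : 0 <= (1 / 2 : R) ^+ m by rewrite exprn_ge0//; lra.
  lra.
pose T w := c%:C + l%:C * (w - a) - c%:C * q w ^+ m.
have FT : polylim T.
  apply: polylimB; last by apply: polylimM; [exact: polylim_cst|exact: polylimX].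
  apply: polylimD; first exact: polylim_cst.
  apply: polylimM; first exact: polylim_cst.
  by apply: polylimB; [exact: polylim_id|exact: polylim_cst].
have [LT LT0 hLT] := polylim_lip (N a + rd) FT.
pose e2 := Num.min (Num.min (1 / 4) (eta / LT)) ((1 / 16 - b) / 2).
have e20 : 0 < e2 by rewrite !lt_min !divr_gt0//; lra.
have e24 : e2 <= 1 / 4 by rewrite !ge_min lexx.
have e2L : LT * e2 <= eta by rewrite mulrC -ler_pdivlMr ?ge_min ?lexx ?orbT.
have e2b : b + e2 <= (b + 1 / 16) / 2.
  have : e2 <= (1 / 16 - b) / 2 by rewrite ge_min lexx orbT.
  lra.
have [t1 t10 ht1] := orb_close (frozen B n) n Fh e20.
pose tau := Num.min t (Num.min t1 eta).
have tau0 : 0 < tau by rewrite !lt_min t0 t10.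
have [h' [Fh' h'h h'T]] := glue_at B n Fh FT tau0.
have taut1 : tau <= t1 by rewrite !ge_min lexx orbT.
have taueta : tau <= eta by rewrite !ge_min lexx !orbT.
have orb' k x : K k -> N (x - k) <= d ->
    [/\ forall j, (j <= n)%N -> N (orb h' j x - orb h j x) <= e2,
    forall j, (j < n)%N -> N (h' (orb h' j x) - h (orb h j x)) <= e2,
    tame B h' n x & N (h' (orb h' n x) - T (orb h n x)) <= 2 * eta].
  move=> Kk hx; have tm := hcen _ _ Kk hx.
  have [||g1 g2] := ht1 h' x.
  - by move=> z /h'h h1; apply: le_trans h1 taut1.
  - apply: (@tame_frozen _ B h n n) => // j jn; have := tm _ jn; lra.
  have tm' : tame B h' n x.
    move=> j jn; have := tm _ jn; have := g1 _ jn.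
    by have := cnormD3 (orb h' j x) (orb h j x) (cen B j); lra.
  split => //.
  have o1 := tm _ (leqnn n); have o2 := tm' _ (leqnn n); have o3 := g1 _ (leqnn n).
  rewrite -/a -/rd in o1 o2.
  apply: le_trans (cnormD3 _ (T (orb h' n x)) _) _.
  have p1 : N (h' (orb h' n x) - T (orb h' n x)) <= eta by apply: le_trans taueta; exact: h'T.
  have p2 : N (T (orb h' n x) - T (orb h n x)) <= eta.
    have a1 := cnormB_ge (orb h' n x) a; have a2 := cnormB_ge (orb h n x) a.
    apply: le_trans (hLT _ _ _ _) _; [lra|lra|].
    by apply: le_trans e2L; rewrite ler_pM2l.
  lra.
have lin k x : K k -> N (x - k) <= d2 ->
    N (h' (orb h' n x) - c%:C - l%:C * (orb h n x - a)) <= 3 * eta.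
  move=> Kk hx; have [_ _ _ h1] := orb' k x Kk ltac:(lra).
  have -> : h' (orb h' n x) - c%:C - l%:C * (orb h n x - a) =
     (h' (orb h' n x) - T (orb h n x)) - c%:C * q (orb h n x) ^+ m by rewrite /T; ring.
  apply: le_trans (cnormBD _ _) _; rewrite cnormM cnormX (cnorm_realp c0).
  have : c * N (q (orb h n x)) ^+ m <= c * (1 / 2) ^+ m.
    by rewrite ler_wpM2l// lerXn2r ?nnegrE ?cnorm_ge0//; exact: qK hx.
  lra.
exists h'; split; last first.
(* At [u] the two constants cancel: only the slope term, at most [1 / 256], and the error [2 * eta]
   remain. *)
- move=> /qu[u [k [us Kk uk qu1]]]; exists u.
  have [_ _ tu hu] := orb' k u Kk ltac:(lra); split => //.
  have o1 := hcen _ _ Kk (ltac:(lra) : N (u - k) <= d) _ (leqnn n).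
  have Tu : T (orb h n u) = l%:C * (orb h n u - a) by rewrite /T qu1 expr1n; ring.
  rewrite -[h' _](subrK (T (orb h n u))) Tu; apply: le_trans (cnormD _ _) _.
  rewrite -{1}Tu cnormM (cnorm_realp (ltW l0)).
  rewrite -/a -/rd in o1; have := cnorm_ge0 (orb h n u - a); nra.
- by move=> z /h'h h1; apply: le_trans h1 _; rewrite ge_min lexx.
split => //.
(* This inverts the linearisation [y = expR c * (1 + l * (w - a))] of [cexp (c + l * (w - a))] and
   then applies [J1]. *)
pose J2 y := J1 (a + ((l * expR c)^-1)%:C * (y - (expR c)%:C)).
(* The value [1 / 32] covers the new index [n]; halving the gap between [b] and [1 / 16] absorbs the
   perturbation at the earlier indices. *)
exists d2, (Num.max (1 / 32) ((b + 1 / 16) / 2)), J2; split.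
- by apply/andP; split; lra.
- by rewrite gt_max; apply/andP; split; lra.
- apply: (polylim_comp FJ1); apply: polylimD; first exact: polylim_cst.
  apply: polylimM; first exact: polylim_cst.
  by apply: polylimB; [exact: polylim_id|exact: polylim_cst].
move=> k x Kk hx; have xd : N (x - k) <= d by lra.
have [g1 g2 tm _] := orb' k x Kk xd; have hlin := lin k x Kk hx.
have o1 := hcen _ _ Kk xd _ (leqnn n); rewrite -/a -/rd in o1.
set sx := orb h n x - a in hlin o1.
set er := h' (orb h' n x) - c%:C - l%:C * sx in hlin.
pose v := l%:C * sx + er.
have hv : h' (orb h' n x) - c%:C = v by rewrite /v /er; ring.
have Nlsx : N (l%:C * sx) <= l * rd.
  by rewrite cnormM (cnorm_realp (ltW l0)) ler_wpM2l ?ltW//; lra.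
have Nv : N v <= l * rd + 3 * eta by apply: le_trans (cnormD _ _) _; rewrite lerD.
have eta_lrd : 3 * eta <= l * rd by nra.
split.
  move=> j; rewrite ltnS leq_eqVlt => /predU1P[->|jn].
    by rewrite -/c hv le_max; apply/orP; left; lra.
  rewrite le_max; apply/orP; right; apply: le_trans e2b.
  apply: le_trans (cnormD3 _ (h (orb h j x)) _) _.
  have [h1 _] := H _ _ Kk xd; have := h1 _ jn; have := g2 _ jn; lra.
rewrite orbS /J2.
have -> : h' (orb h' n x) = v + c%:C by rewrite -hv subrK.
rewrite cexpD cexp_real.
have Ec := expR_gt0 c.
have le0 : l != 0 by rewrite gt_eqF.
have Ec0 : expR c != 0 by rewrite gt_eqF.
have leC : l%:C != 0 by rewrite -cnorm_gt0 (cnorm_realp (ltW l0)).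
have EcC : (expR c)%:C != 0 by rewrite -cnorm_gt0 (cnorm_realp (ltW Ec)).
have -> : a + ((l * expR c)^-1)%:C * (cexp v * (expR c)%:C - (expR c)%:C) =
    orb h n x + l%:C^-1 * (er + (cexp v - 1 - v)).
  rewrite fmorphV rmorphM /=.
  have -> : orb h n x = a + l%:C^-1 * (v - er) by rewrite /v /sx; field.
  by field; rewrite leC EcC.
set y := l%:C^-1 * _.
have Ny : N y <= rho.
  rewrite cnormM cnormV (cnorm_realp (ltW l0)) ler_pdivrMl//.
  apply: le_trans (cnormD _ _) _.
  have := @cexp_quad R v ltac:(lra).
  have : 4 * N v ^+ 2 <= 4 * (2 * (l * rd)) ^+ 2.
    by rewrite ler_pM2l// lerXn2r ?nnegrE ?cnorm_ge0//; [have := cnorm_ge0 v; lra|lra].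
  have -> : 4 * (2 * (l * rd)) ^+ 2 = 1 / 2 * (l * (l * (32 * rd ^+ 2))) by field.
  rewrite lrd; lra.
apply: le_trans (cnormD3 _ (J1 (orb h n x)) _) _.
have k1 : N (J1 (orb h n x) - x) <= d2 / 128 by apply: (hJ1 k) => //; lra.
have k2 : N (J1 (orb h n x + y) - J1 (orb h n x)) <= d2 / 128.
  have a1 : N (orb h n x) <= N a + rd.
    rewrite -[orb h n x](subrK a) -/sx; apply: le_trans (cnormD _ _) _; lra.
  apply: le_trans (hL _ _ _ _) _.
  - by apply: le_trans (cnormD _ _) _; lra.
  - lra.
  - apply: le_trans rhoL; rewrite ler_pM2l//.
    by rewrite addrAC subrr add0r.
lra.
Qed.

End Step.

(** * The limit function *)

Section Limit.
Context (R : realType).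
Local Notation N := (@cnorm R).
Implicit Types (f g h : R[i] -> R[i]) (z w u v x y k : R[i]) (n j m : nat).

(** The quantification over all [h'] is meant for the final limit, of which only its closeness to
    [h] on the newly frozen disc is known at this stage. *)
Definition stable (K : set R[i]) (B : R) n h (t : R) :=
  forall h', polylim h' -> (forall z, N z <= frozen B n.+1 -> N (h' z - h z) <= t) ->
  [/\ forall x, K x -> N (h' (orb h' n x) - (ctr B n)%:C) <= 1 / 8,
      set_inj K (orb h' n.+1) &
      forall u, tame B h n u -> N (h (orb h n u)) <= 1 -> N (h' (orb h' n u)) <= 2].

Lemma good_stable (K : set R[i]) (B : R) n h : 0 <= B -> (forall z, K z -> N z <= B) ->
  good K B n.+1 h -> exists2 t : R, 0 < t & stable K B n h t.
Proof.
move=> B0 KB [Fh [d [b [J [/andP[d0 dh] b16 FJ H]]]]].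
have [L L0 hL] := polylim_lip (N (cen B n.+1) + rad B n.+1 + 1) FJ.
pose e := Num.min (1 / 16) (d / (64 * L)).
have e0 : 0 < e by rewrite lt_min !divr_gt0 ?mulr_gt0.
have e16 : e <= 1 / 16 by rewrite ge_min lexx.
have eL : L * e <= d / 64.
  have : e * (64 * L) <= d by rewrite -ler_pdivlMr ?mulr_gt0// ge_min lexx orbT.
  lra.
have [t t0 ht] := orb_close (frozen B n.+1) n.+1 Fh e0.
exists t => // h' Fh' h'h.
have near k x : K k -> N (x - k) <= d ->
    [/\ forall j, (j <= n.+1)%N -> N (orb h j x - cen B j) + 1 / 2 <= rad B j,
    forall j, (j <= n.+1)%N -> N (orb h' j x - orb h j x) <= e &
    forall j, (j < n.+1)%N -> N (h' (orb h' j x) - h (orb h j x)) <= e].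
  move=> Kk hx; have [h1 _] := H _ _ Kk hx.
  have tm : forall j, (j <= n.+1)%N -> N (orb h j x - cen B j) + 1 / 2 <= rad B j.
    apply: (orb_cen B0 b16) => //.
    by rewrite -[x](subrK k); apply: le_trans (cnormD _ _) _; have := KB _ Kk; lra.
  have [//||g1 g2] := ht h' x; last by split.
  by apply: (@tame_frozen _ B h n.+1 n.+1) => // j jn; have := tm _ jn; lra.
split.
- move=> x Kx; have xx : N (x - x) <= d by rewrite subrr cnorm0 ltW.
  have [_ _ h1] := near x x Kx xx; have {}h1 := h1 n (ltnSn n).
  have [h2 _] := H x x Kx xx; have {}h2 := h2 n (ltnSn n).
  by have := cnormD3 (h' (orb h' n x)) (h (orb h n x)) (ctr B n)%:C; lra.
- apply: (@near_id_inj R K d (orb h' n.+1) J d0).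
    exact: (polylim_comp FJ (polylim_orb n.+1 Fh')).
  move=> k x Kk hx; have [h1 h2 _] := near k x Kk hx.
  have {}h1 := h1 _ (leqnn _); have {}h2 := h2 _ (leqnn _).
  have [_ h3] := H k x Kk hx.
  have a1 := cnormB_ge (orb h n.+1 x) (cen B n.+1).
  have a2 := cnormB_ge (orb h' n.+1 x) (orb h n.+1 x).
  apply: le_trans (cnormD3 _ (J (orb h n.+1 x)) _) _.
  have : N (J (orb h' n.+1 x) - J (orb h n.+1 x)) <= L * e.
    apply: le_trans (hL _ _ _ _) _; [lra|lra|].
    by rewrite ler_pM2l.
  lra.
- move=> u tu hu; have [//||_ h2] := ht h' u.
    exact: (tame_frozen B0 tu (leqnn _)).
  have {}h2 := h2 n (ltnSn n).
  by have := cnormB_ge (h' (orb h' n u)) (h (orb h n u)); lra.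
Qed.

Lemma escaping_function (K : set (Cplx R)) (B : R) (q0 : nat -> R[i]) (s : nat -> R) :
  closed K -> 0 <= B -> (forall z, K z -> N z <= B) -> connected (~` K) ->
  exists h, [/\ polylim h,
    forall n x, K x -> N (h (orb h n x) - (ctr B n)%:C) <= 1 / 8,
    forall n, set_inj K (orb h n.+1) &
    forall n, meets_frontier K (q0 n) (s n) -> exists u,
      N (u - q0 n) < s n /\ N (h (orb h n u)) <= 2].
Proof.
move=> Kc B0 KB Kcon.
pose P n (a : (R[i] -> R[i]) * R) := good K B n a.1 /\ 0 < a.2.
pose Q n (a a' : (R[i] -> R[i]) * R) := [/\ P n.+1 a', a'.2 <= a.2 / 2,
  forall z, N z <= frozen B n -> N (a'.1 z - a.1 z) <= a.2 / 2,
  stable K B n a'.1 a'.2 &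
  meets_frontier K (q0 n) (s n) -> exists u, [/\ N (u - q0 n) < s n,
      tame B a'.1 n u & N (a'.1 (orb a'.1 n u)) <= 1]].
have step n a : P n a -> exists a', Q n a a'.
  move=> [Ga a0]; have a20 : 0 < a.2 / 2 by lra.
  have [h' [Gh' h'a hu]] := good_step (s n) (q0 n) Kc B0 KB Kcon a20 Ga.
  have [t t0 ht] := good_stable B0 KB Gh'.
  exists (h', Num.min t (a.2 / 2)); split => //=.
  - by split => //=; rewrite lt_min t0.
  - by rewrite ge_min lexx orbT.
  - move=> g Fg gh; apply: ht => // z hz; apply: le_trans (gh _ hz) _.
    by rewrite ge_min lexx.
(* Dependent choice: off [P] the selected value is arbitrary, so that [F] can be iterated as a total
   function. *)
have [F hF] : exists F : nat -> (R[i] -> R[i]) * R -> (R[i] -> R[i]) * R,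
    forall n a, P n a -> Q n a (F n a).
  have /choice[F hF] : forall na : nat * ((R[i] -> R[i]) * R), exists a',
      P na.1 na.2 -> Q na.1 na.2 a'.
    move=> [n a]; have [/step[a' ?]|nP] := pselect (P n a); first by exists a'.
    by exists a.
  by exists (fun n a => F (n, a)) => n a; exact: (hF (n, a)).
(* The zero function is [good] at stage 0: no target has been visited, and [id] inverts the empty
   orbit. *)
pose A := fix A n := if n is n'.+1 then F n' (A n') else (fun=> 0, 1).
have PA n : P n (A n).
  elim: n => [|n /hF[]//]; split => //=.
  split; first exact: polylim_cst.
  exists (1 / 2), 0, id; split; rewrite ?divr_gt0//; [|exact: polylim_id|].
    by apply/andP; split; lra.
  by move=> k x Kk hx; split => //; rewrite subrr cnorm0; lra.
have QA n : Q n (A n) (A n.+1) by exact: hF.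
pose t n := (A n).2; pose g n := (A n).1.
have t0 n : 0 < t n by have [] := PA n.
have tS n : t n.+1 <= t n / 2 by have [] := QA n.
have frozenS n : frozen B n <= frozen B n.+1.
  case: n => [|n]; last by rewrite /frozen; have := @expR_ctr_le _ B n n.+1 B0 (leqnSn n); lra.
  by have := frozen_ge 0 B0; rewrite /frozen; lra.
have frozen_le n m : (n <= m)%N -> frozen B n <= frozen B m.
  elim: m => [|m IH]; first by rewrite leqn0 => /eqP->.
  by rewrite leq_eqVlt ltnS => /predU1P[->//|/IH h]; exact: le_trans h _.
(* The tolerances at least halve, so the change [t m / 2] made at stage [m] is at most
   [t m - t m.+1] and the changes telescope. *)
have gg n m z : (n <= m)%N -> N z <= frozen B n -> N (g m z - g n z) <= t n - t m.
  elim: m => [|m IH]; first by rewrite leqn0 => /eqP-> _; rewrite !subrr cnorm0.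
  rewrite leq_eqVlt ltnS => /predU1P[->|nm] hz; first by rewrite !subrr cnorm0.
  have h1 := IH nm hz; apply: le_trans (cnormD3 _ (g m z) _) _.
  have [_ _ /(_ z (le_trans hz (frozen_le _ _ nm))) h2 _ _] := QA m.
  by have := tS m; rewrite -/(g _) -/(g _) -/(t _) in h2; have := t0 m; lra.
have t_le n m : (n <= m)%N -> t m <= t n.
  elim: m => [|m IH]; first by rewrite leqn0 => /eqP->.
  rewrite leq_eqVlt ltnS => /predU1P[->//|/IH]; have := tS m; have := t0 m; lra.
have t_small (e : R) : 0 < e -> exists n, t n <= e.
  move=> e0; have [|n hn] := @exp_small R (1 / 2) e _ e0; first by apply/andP; split; lra.
  exists n; apply: le_trans hn; elim: n => [|n IH]; first by rewrite expr0.
  by rewrite exprS; have := tS n; lra.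
have in_frozen (r : R) n : exists2 m, (n <= m)%N & r <= frozen B m.
  exists (maxn n (Num.bound `|r|).+1); first exact: leq_maxl.
  apply: le_trans (frozen_le (Num.bound `|r|).+1 _ (leq_maxr _ _)).
  apply: le_trans (frozen_ge _ B0); apply: le_trans (ler_norm _) _.
  by apply/ltW/archi_boundP.
have /choice[h hh] : forall z, exists l, forall n, N z <= frozen B n -> N (l - g n z) <= t n.
  move=> z; have [|l hl] := @complex_cauchy_cvg R (fun n => g n z).
    move=> e /t_small[n1 h1]; have [m nm hm] := in_frozen (N z) n1.
    exists m => n mn; rewrite cnormB; apply: le_trans (gg _ _ _ mn hm) _.
    have := t_le _ _ nm; have := t0 n; lra.
  exists l => n hn; apply/ler_addgt0Pr => e /hl[n0 h0].
  apply: le_trans (cnormD3 _ (g (maxn n n0) z) _) _.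
  rewrite cnormB; have h1 := h0 _ (leq_maxr n n0).
  have h2 := gg _ _ _ (leq_maxl n n0) hn; have := t0 (maxn n n0); lra.
have Fh : polylim h.
  apply: polylim_close => r e /t_small[n hn]; have [m nm hm] := in_frozen r n.
  exists (g m); first by have [[]] := PA m.
  move=> z hz; apply: le_trans (hh _ _ (le_trans hz hm)) _; apply: le_trans hn.
  exact: t_le.
(* The limit differs from [g n.+1] by at most [t n.+1] on the disc frozen at that stage, so [stable]
   applies to [h] itself. *)
have st n : [/\ forall x, K x -> N (h (orb h n x) - (ctr B n)%:C) <= 1 / 8,
      set_inj K (orb h n.+1) &
      forall u, tame B (g n.+1) n u -> N (g n.+1 (orb (g n.+1) n u)) <= 1 ->
        N (h (orb h n u)) <= 2].
  by have [_ _ _ stn _] := QA n; apply: stn => // z; exact: hh.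
exists h; split => //.
- by move=> n; have [] := st n.
- by move=> n; have [] := st n.
- move=> n mf; have [_ _ st3] := st n; have [_ _ _ _ /(_ mf)[u [us tu hu]]] := QA n.
  by exists u; split => //; exact: st3.
Qed.

End Limit.

(** * Connectedness of the preimage *)

Section ExpPreimage.
Context (R : realType).
Local Notation N := (@cnorm R).
Local Notation C := (Cplx R).

Lemma continuous_complex (T : topologicalType) (a b : T -> R) (t : T) :
  {for t, continuous a} -> {for t, continuous b} ->
  {for t, continuous ((fun s => Complex (a s) (b s)) : T -> C)}.
Proof.
move=> ca cb; apply/cvgrPdist_lt => e e0.
have [k ek] : exists k, e = k%:C by apply/complex_realP; rewrite gtr0_real.
have k0 : 0 < k / 2 by rewrite divr_gt0// -ltcR -ek.
have /cvgrPdist_lt/(_ _ k0) ha := ca; have /cvgrPdist_lt/(_ _ k0) hb := cb.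
near=> s; rewrite ek cnormE ltcR; apply: le_lt_trans (cnorm_le_ReIm _) _.
have h1 : `|a t - a s| < k / 2 by near: s.
have h2 : `|b t - b s| < k / 2 by near: s.
by rewrite /=; lra.
Unshelve. all: by end_near. Qed.

Lemma polylim_continuous (f : R[i] -> R[i]) : polylim f -> continuous (f : C -> C).
Proof.
move=> Ff z; apply/continuous_cnormP => e e0.
have [L L0 hL] := polylim_lip (N z + 1) Ff.
exists (Num.min 1 (e / L)) => [|w]; first by rewrite lt_min ltr01 divr_gt0.
rewrite lt_min => /andP[w1 w2]; rewrite ltr_pdivlMr// mulrC in w2.
apply: le_lt_trans w2; apply: hL; last lra.
by rewrite -[w](subrK z); apply: le_trans (cnormD _ _) _; rewrite addrC lerD2l ltW.
Qed.

(** The principal logarithm in the right half-plane; the formula with [atan] is correct only for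
    [0 < x]. *)
Definition clog (x y : R) : C :=
  Complex (ln (x ^+ 2 + y ^+ 2) / 2) (atan (y / x)).

Lemma clogK x y : 0 < x -> cexp (clog x y) = Complex x y.
Proof.
move=> x0; set q := x ^+ 2 + y ^+ 2.
have q0 : 0 < q by rewrite /q ltr_pwDl ?sqr_ge0// exprn_gt0.
set m := expR (ln q / 2); have m0 : 0 < m := expR_gt0 _.
have mm : m ^+ 2 = q by rewrite -expRM_natl mulrC divfK// lnK.
have c : cos (atan (y / x)) = x / m.
  rewrite cos_atan; have -> : 1 + (y / x) ^+ 2 = (m / x) ^+ 2.
    by rewrite [RHS]expr_div_n mm /q; field; rewrite gt_eqF.
  by rewrite sqrtr_sqr ger0_norm ?invf_div// divr_ge0 ?ltW.
have s : sin (atan (y / x)) = y / m.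
  have := atanK (y / x); rewrite /tan c => h.
  have -> : sin (atan (y / x)) = y / x * (x / m).
    by rewrite -[y / x in RHS]h divfK// mulf_neq0 ?invr_eq0 ?gt_eqF.
  by field; rewrite !gt_eqF.
rewrite /clog /cexp /= -/q -/m c s; congr Complex; field; exact: lt0r_neq0.
Qed.

(** The lift through [cexp], starting at [b], of the segment from [cexp b] to [cexp b * (1 + s)]. *)
Definition lift_path (b s : R[i]) (t : R) : C :=
  b + clog (1 + t * complex.Re s) (t * complex.Im s).

Lemma continuous_lift_path (b s : R[i]) (t : R) : 0 < 1 + t * complex.Re s ->
  {for t, continuous (lift_path b s)}.
Proof.
case: s => a c /= h0; apply: (@continuousD R[i] C); first exact: cst_continuous.
have cx : {for t, continuous (fun u : R => 1 + u * a)}.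
  apply: continuousD; first exact: cst_continuous.
  by apply: continuousM; [exact: id|exact: cst_continuous].
have cy : {for t, continuous (fun u : R => u * c)}.
  by apply: continuousM; [exact: id|exact: cst_continuous].
apply: continuous_complex.
  apply: continuousM; last exact: cst_continuous.
  apply: (@continuous_comp _ _ _ (fun u : R => (1 + u * a) ^+ 2 + (u * c) ^+ 2) (@ln R)).
    by apply: continuousD; apply: continuousM.
  by apply: continuous_ln; rewrite ltr_pwDl ?sqr_ge0// exprn_gt0.
apply: (@continuous_comp _ _ _ (fun u : R => u * c / (1 + u * a)) (@atan R)).
  by apply: continuousM => //; apply: continuousV => //; rewrite gt_eqF.
exact: continuous_atan.
Qed.

Lemma cexp_lift_path (b s : R[i]) (t : R) : 0 < 1 + t * complex.Re s ->
  cexp (lift_path b s t) = cexp b * (1 + t%:C * s).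
Proof.
move=> h; rewrite /lift_path cexpD clogK//.
case: s h => a c h; congr (_ * _); apply/eqP; rewrite eq_complex /=.
by apply/andP; split; apply/eqP; ring.
Qed.

Lemma lift_path0 (b s : R[i]) : lift_path b s 0 = b.
Proof.
rewrite /lift_path /clog !mul0r addr0 expr0n expr1n addr0 ln1 mul0r atan0.
exact: addr0.
Qed.

Lemma connected_segment (u v : C) :
  connected ((fun t : R => u + t%:C * (v - u)) @` `[0, 1]).
Proof.
apply: connected_continuous_connected; first exact: segment_connected.
apply: continuous_subspaceT => t; case: u v => [a a'] [b b'].
have -> : (fun x : R => Complex a a' + x%:C * (Complex b b' - Complex a a') : C) =
    (fun x : R => Complex (a + x * (b - a)) (a' + x * (b' - a'))).
  by apply/funext => x; apply/eqP; rewrite eq_complex /=; apply/andP; split; apply/eqP; ring.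
have lin c d : {for t, continuous (fun x : R => c + x * d)}.
  apply: continuousD; first exact: cst_continuous.
  by apply: continuousM; [exact: id|exact: cst_continuous].
exact: (continuous_complex (lin _ _) (lin _ _)).
Qed.

Lemma connected_meet (T : topologicalType) (S A X D E : set T) : connected S ->
  S `<=` A -> open D -> X = A `&` D -> closed E -> X = A `&` E ->
  S `&` X !=set0 -> S `<=` X.
Proof.
move=> cS SA oD XD cE XE SX.
have <- : S `&` X = S.
  apply: cS => //.
    by exists D => //; rewrite XD setIA (setIidl SA).
  by exists E => //; rewrite XE setIA (setIidl SA).
exact: subIsetr.
Qed.

(* A clopen piece of the preimage that misses the half-plane above a disc around
   [0] would have a clopen image in [O] that misses [0]. *)
Lemma connected_cexp_preimage (O : set C) :
  open O -> connected O -> O 0 -> connected (@cexp R @^-1` O).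
Proof.
move=> oO cO O0; set Om := _ @^-1` _.
have [r r0 hr] := (open_cnormP O).1 oO _ O0.
pose H := [set z : C | expR (complex.Re z) < r].
have HOm : H `<=` Om by move=> z Hz; apply: hr; rewrite subr0 cnorm_cexp.
have core X D E : X !=set0 -> open D -> X = Om `&` D -> closed E -> X = Om `&` E ->
    X `&` H !=set0.
  move=> X0 oD XD cE XE; apply: contrapT => XH.
  have XOm : X `<=` Om by rewrite XD; exact: subIsetl.
  (* The clopen piece [X] swallows the lift from [b] of the segment from [cexp b] to [v]; hence its
     image contains every disc about [cexp b] that lies in [O] and misses [0]. *)
  have lift b rho v : X b -> 0 < rho -> rho <= N (cexp b) ->
      (forall w, N (w - cexp b) < rho -> O w) -> N (v - cexp b) < rho ->
      (@cexp R @` X) v.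
    move=> Xb rho0 hrho hO hv; set y := cexp b in hrho hO hv.
    have y0 : 0 < N y by rewrite cnorm_cexp expR_gt0.
    pose s := (v - y) / y.
    have s1 : N s < 1 by rewrite cnormM cnormV ltr_pdivrMr// mul1r; lra.
    have pos t : t \in `[0, 1]%R -> 0 < 1 + t * complex.Re s.
      rewrite in_itv /= => /andP[t0 t1].
      have h1 := normr_Re s; have h2 := ler_norm (- complex.Re s); rewrite normrN in h2.
      have p1 : - 1 < complex.Re s by lra.
      by have [h|h] := leP t (1 / 2); nra.
    have sub : lift_path b s @` `[0, 1] `<=` Om.
      move=> _ [t t01 <-]; rewrite /Om /= cexp_lift_path ?pos//.
      apply: hO; have -> : cexp b * (1 + t%:C * s) - cexp b = t%:C * (v - y).
        by rewrite /s -/y; field; rewrite -cnorm_gt0.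
      move: t01; rewrite /= in_itv /= => /andP[t0 t1].
      rewrite cnormM cnorm_realp//; have := cnorm_ge0 (v - y); nra.
    have con : connected (lift_path b s @` `[0, 1]).
      apply: connected_continuous_connected; first exact: segment_connected.
      apply: continuous_in_subspaceT => t; rewrite inE => /pos; exact: continuous_lift_path.
    have sX : lift_path b s @` `[0, 1] `<=` X.
      apply: (connected_meet con sub oD XD cE XE); exists b; split => //.
      by exists 0; [rewrite /= in_itv /= lexx ler01|exact: lift_path0].
    exists (lift_path b s 1).
      by apply: sX; exists 1 => //=; rewrite in_itv /= ler01 lexx.
    rewrite cexp_lift_path; last by apply: pos; rewrite in_itv /= ler01 lexx.
    by rewrite mul1r /s -/y; field; rewrite -cnorm_gt0.
  have EO : @cexp R @` X = O.
    apply: cO.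
    - by case: X0 => b Xb; exists (cexp b), b.
    - exists (@cexp R @` X); last first.
        by apply/esym/setIidr => _ [b Xb <-]; exact: XOm.
      apply/open_cnormP => _ [b Xb <-].
      have [rho rho0 hrho] := (open_cnormP O).1 oO _ (XOm _ Xb).
      have Nb : 0 < N (cexp b) by rewrite cnorm_cexp expR_gt0.
      exists (Num.min rho (N (cexp b))) => [|v hv]; first by rewrite lt_min rho0.
      apply: (lift b _ v Xb _ _ _ hv); first by rewrite lt_min rho0.
        by rewrite ge_min lexx orbT.
      by move=> w; rewrite lt_min => /andP[/hrho].
    - exists (closure (@cexp R @` X)); first exact: closed_closure.
      apply/seteqP; split.
        by move=> v Xv; split; [case: Xv => b Xb <-; exact: XOm|exact: subset_closure].
      move=> y [Oy /closure_cnormP cl].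
      (* If [0] were a limit of the image, [X] would contain a point with [cexp] of modulus below
         [r], that is, a point of [H]. *)
      have [y0|y0] := eqVneq y 0.
        have [_ [b Xb <-]] := cl _ r0; rewrite y0 subr0 cnorm_cexp => hb.
        by exfalso; apply: XH; exists b.
      have [rho1 rho10 hrho1] := (open_cnormP O).1 oO _ Oy.
      pose rho := Num.min rho1 (N y).
      have rho0 : 0 < rho by rewrite lt_min rho10 cnorm_gt0.
      have rhoy : rho <= N y by rewrite ge_min lexx orbT.
      have hrho w : N (w - y) < rho -> O w.
        by rewrite lt_min => /andP[/hrho1].
      have [|_ [b Xb <-] hb] := cl (rho / 3); first lra.
      apply: (lift b (2 / 3 * rho) y Xb); first lra.
      + have := cnormB_ge y (y - cexp b); have -> : y - (y - cexp b) = cexp b by ring.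
        by rewrite (cnormB y); lra.
      + move=> w hw; apply: hrho; apply: le_lt_trans (cnormD3 _ (cexp b) _) _; lra.
      + by rewrite cnormB; lra.
  have : O 0 := O0; rewrite -EO => -[b _ /eqP]; apply/negP; exact: cexp_neq0.
move=> X X0 [D oD XD] [E cE XE].
have XOm : X `<=` Om by rewrite XD; exact: subIsetl.
apply/seteqP; split => // z Oz; apply: contrapT => nXz.
have XcE : Om `\` X = Om `&` ~` E by rewrite XE setDIr setDv set0U.
have XcD : Om `\` X = Om `&` ~` D by rewrite XD setDIr setDv set0U.
(* Both [X] and its complement in [Om] are clopen, so both meet [H]; but [H] is convex, and a
   segment inside it cannot leave [X]. *)
have [u [[Ou nXu] Hu]] : (Om `\` X) `&` H !=set0.
  apply: (core _ (~` E) (~` D)) => //; first by exists z.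
    exact: closed_openC.
  exact: open_closedC.
have [v [Xv Hv]] := core X D E X0 oD XD cE XE.
have sOm : (fun t : R => v + t%:C * (u - v)) @` `[0, 1] `<=` Om.
  move=> _ [t /= + <-]; rewrite in_itv /= => /andP[t0 t1]; apply: HOm.
  rewrite /H /=; case: u v Hu Hv {Ou nXu Xv} => [a a'] [b b']; rewrite /H /= => Hu Hv.
  have [ab|ab] := leP a b.
    by apply: le_lt_trans Hv; rewrite ler_expR mul0r subr0; nra.
  by apply: le_lt_trans Hu; rewrite ler_expR mul0r subr0; nra.
have sX : (fun t : R => v + t%:C * (u - v)) @` `[0, 1] `<=` X.
  apply: (connected_meet (@connected_segment v u) sOm oD XD cE XE).
  exists v; split => //; exists 0; last by rewrite mul0r addr0.
  by rewrite /= in_itv /= lexx ler01.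
by apply: nXu; apply: sX; exists 1;
  [rewrite /= in_itv /= ler01 lexx|rewrite mul1r addrC subrK].
Qed.

End ExpPreimage.

(** * The chordal metric *)

Section Chordal.
Context (R : realType).
Local Notation N := (@cnorm R).
Local Notation C := (Cplx R).
Implicit Types (z w : R[i]) (q : sphere R) (x : R).

Lemma sqrt1D_bounds x : 0 <= x ->
  [/\ 0 < Num.sqrt (1 + x ^+ 2), x <= Num.sqrt (1 + x ^+ 2)
    & Num.sqrt (1 + x ^+ 2) <= 1 + x].
Proof.
move=> x0; have x2 := sqr_ge0 x.
split; first by rewrite sqrtr_gt0; lra.
- by rewrite -[leLHS]ger0_norm// -sqrtr_sqr ler_sqrt; lra.
- by rewrite -[leRHS]ger0_norm ?addr_ge0// -sqrtr_sqr ler_sqrt ?sqr_ge0//; nra.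
Qed.

Lemma chordal_fin_ge z w :
  2 * N (z - w) / ((1 + N z) * (1 + N w)) <= chordal (Some z : sphere R) (Some w).
Proof.
have [z0 _ z1] := sqrt1D_bounds (cnorm_ge0 z).
have [w0 _ w1] := sqrt1D_bounds (cnorm_ge0 w).
rewrite /chordal ler_wpM2l ?mulr_ge0 ?cnorm_ge0// lef_pV2 ?posrE ?mulr_gt0//.
- by apply: ler_pM => //; exact: ltW.
- by have := cnorm_ge0 z; lra.
- by have := cnorm_ge0 w; lra.
Qed.

Lemma chordal_infty_le z x : 0 < x -> x <= N z -> chordal (Some z : sphere R) None <= 2 / x.
Proof.
move=> x0 xz; have [z0 z1 _] := sqrt1D_bounds (cnorm_ge0 z).
rewrite /chordal ler_pM2l// lef_pV2 ?posrE//; lra.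
Qed.

Lemma chordal_infty_ge z : 2 / (1 + N z) <= chordal (Some z : sphere R) None.
Proof.
have [z0 _ z1] := sqrt1D_bounds (cnorm_ge0 z).
by rewrite /chordal ler_pM2l// lef_pV2 ?posrE//; have := cnorm_ge0 z; lra.
Qed.

(** This takes the place of a triangle inequality for [chordal]. A finite [q] near [w] has modulus
    below 3, and then closeness to [z] would give [N z < 5]; the point at infinity is already too
    far from [w]. *)
Lemma chordal_separated z w q : 11 <= N z -> N w <= 2 ->
  chordal (Some z : sphere R) q < 1 / 6 -> chordal (Some w : sphere R) q < 1 / 6 -> False.
Proof.
move=> z11 w2; have w0 := cnorm_ge0 w; case: q => [q|]; last first.
  move=> _; apply/negP; rewrite -leNgt; apply: le_trans (chordal_infty_ge w).
  by rewrite ler_pdivlMr; lra.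
move=> zq wq; have q0 := cnorm_ge0 q.
have {zq} := le_lt_trans (chordal_fin_ge z q) zq.
have {wq} := le_lt_trans (chordal_fin_ge w q) wq.
have wq := cnormB_ge q w; have zq := cnormB_ge z q; rewrite (cnormB q) in wq.
rewrite !ltr_pdivrMr; try nra.
Qed.

Lemma chordal_fin_far z w : 2 * N w + 1 <= N z ->
  1 / (1 + N w) <= chordal (Some z : sphere R) (Some w).
Proof.
move=> zw; apply: le_trans (chordal_fin_ge z w).
have z0 := cnorm_ge0 z; have w0 := cnorm_ge0 w.
rewrite ler_pdivrMr; last lra.
rewrite mulrAC ler_pdivlMr; last nra.
have := cnormB_ge z w; nra.
Qed.

End Chordal.

(** * Extraction of subsequences of natural numbers *)

Section Subsequences.

Lemma extraction (P : nat -> Prop) : (forall k0, exists2 k, (k0 <= k)%N & P k) ->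
  exists phi : nat -> nat, increasing_seq phi /\ forall n, P (phi n).
Proof.
move=> H; have /choice[F hF] : forall k0, exists k, (k0 <= k)%N /\ P k.
  by move=> k0; have [k ? ?] := H k0; exists k.
pose phi := fix phi n := if n is n'.+1 then F (phi n').+1 else F 0%N.
exists phi; split; last by case=> [|n]; apply: (hF _).2.
apply/increasing_seqP => n; exact: (hF _).1.
Qed.

Lemma bounded_infinitely_often (m : nat -> nat) (M : nat) :
  (forall k0, exists2 k, (k0 <= k)%N & (m k < M)%N) ->
  exists v, forall k0, exists2 k, (k0 <= k)%N & m k = v.
Proof.
elim: M => [/(_ 0%N)[]//|M IH] H.
have [h|] := pselect (forall k0, exists2 k, (k0 <= k)%N & m k = M); first by exists M.
move=> /existsNP[k1 h1]; apply: IH => k0.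
have [k] := H (maxn k0 k1); rewrite geq_max => /andP[k0k k1k].
rewrite ltnS leq_eqVlt => /predU1P[kM|kM]; last by exists k.
by exfalso; apply: h1; exists k.
Qed.

End Subsequences.

(** * Compact boxes, periodicity and local inversion of the exponential *)

Section Dynamics.
Context (R : realType).
Local Notation N := (@cnorm R).
Local Notation C := (Cplx R).

Lemma compact_box (z : C) (d : R) : compact
  [set w : C | `|complex.Re w - complex.Re z| <= d /\ `|complex.Im w - complex.Im z| <= d].
Proof.
set a := complex.Re z; set b := complex.Im z.
have -> : [set w : C | `|complex.Re w - a| <= d /\ `|complex.Im w - b| <= d] =
    (fun p : R * R => Complex p.1 p.2 : C) @` (`[a - d, a + d] `*` `[b - d, b + d]).
  apply/seteqP; split => w.
    case: w => x y /= [hx hy]; exists (x, y) => //=; rewrite !in_itv /=.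
    by move: hx hy; rewrite !ler_norml => /andP[? ?] /andP[? ?]; split; apply/andP; split; lra.
  move=> [[x y] /= [+ +] <-]; rewrite !in_itv /= => /andP[? ?] /andP[? ?].
  by rewrite !ler_norml; split; apply/andP; split; lra.
apply: continuous_compact; last by apply: compact_setX; exact: segment_compact.
apply: continuous_subspaceT => p.
by apply: continuous_complex; [exact: cvg_fst|exact: cvg_snd].
Qed.

Lemma cexp_2piM (z : C) (k : nat) : cexp (z + k%:R * Complex 0 (pi *+ 2)) = cexp z.
Proof.
rewrite cexpD cexpMn; have -> : cexp (Complex 0 (pi *+ 2) : R[i]) = 1.
  by rewrite /cexp /= cos2pi sin2pi expR0 mulr1 mulr0.
by rewrite expr1n mulr1.
Qed.

(** The preimage is [z] plus the principal logarithm of [u / cexp z], small by continuity of [ln] at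
    [1] and [atan] at [0]. It transfers returning points near [cexp z] to points near [z]. *)
Lemma cexp_open (z : R[i]) (e : R) : 0 < e -> exists2 d : R, 0 < d &
  forall u, N (u - cexp z) < d -> exists2 w, N (w - z) < e & cexp w = u.
Proof.
move=> e0; have e2 : 0 < e / 2 by lra.
have [d1 /= d10 h1] : exists2 d : R, 0 < d & forall x, `|x - 1| < d -> `|ln x| < e / 2.
  have /cvgrPdist_lt/(_ _ e2)/nbhs_ballP[d /= d0 h] := @continuous_ln R 1 ltr01.
  exists d => // x hx; have := h x; rewrite -ball_normE /= distrC ln1 sub0r normrN; exact.
have [d2 /= d20 h2] : exists2 d : R, 0 < d & forall x, `|x| < d -> `|atan x| < e / 2.
  have /cvgrPdist_lt/(_ _ e2)/nbhs_ballP[d /= d0 h] := @continuous_atan R 0.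
  exists d => // x hx; have := h x; rewrite -ball_normE /= atan0 !sub0r !normrN; exact.
have y0 : 0 < N (cexp z) by rewrite cnorm_cexp expR_gt0.
pose d := Num.min (1 / 2) (Num.min (d1 / 4) (d2 / 2)).
have d0 : 0 < d by rewrite !lt_min !divr_gt0.
exists (d * N (cexp z)) => [|u hu]; first exact: mulr_gt0.
pose s := (u - cexp z) / cexp z.
have : N s < d by rewrite cnormM cnormV ltr_pdivrMr.
rewrite /d !lt_min => /and3P[s1 s2 s3].
have us : u = cexp z * (1 + s) by rewrite /s; field; rewrite -cnorm_gt0.
have := normr_Im s; have := normr_Re s.
set a := complex.Re s; set b := complex.Im s => ha hb.
have a12 : `|a| <= 1 / 2 by lra.
have /andP[a1 a2] : - (1 / 2) <= a <= 1 / 2 by rewrite -ler_norml.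
have n0 := normr_ge0 a; have n1 := normr_ge0 b.
have aa : a ^+ 2 = `|a| ^+ 2 by rewrite real_normK ?num_real.
have bb : b ^+ 2 = `|b| ^+ 2 by rewrite real_normK ?num_real.
exists (z + clog (1 + a) b).
  rewrite addrAC subrr add0r; apply: le_lt_trans (cnorm_le_ReIm _) _ => /=.
  have k1 : `|ln ((1 + a) ^+ 2 + b ^+ 2)| < e / 2.
    apply: h1; have -> : (1 + a) ^+ 2 + b ^+ 2 - 1 = 2 * a + (a ^+ 2 + b ^+ 2) by ring.
    apply: le_lt_trans (ler_normD _ _) _; rewrite normrM (ger0_norm (_ : 0 <= 2)) ?ler0n//.
    rewrite (ger0_norm (_ : 0 <= a ^+ 2 + b ^+ 2)) ?addr_ge0 ?sqr_ge0// aa bb; nra.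
  have k2 : `|atan (b / (1 + a))| < e / 2.
    apply: h2; rewrite normrM normfV ltr_pdivrMr (ger0_norm (_ : 0 <= 1 + a)); nra.
  rewrite normrM (ger0_norm (_ : 0 <= 2^-1)) ?invr_ge0 ?ler0n//.
  by have := normr_ge0 (ln ((1 + a) ^+ 2 + b ^+ 2)); lra.
rewrite cexpD clogK; last lra.
rewrite us; congr (_ * _); apply/eqP; rewrite eq_complex /= /a /b.
by case: (s) => ? ? /=; rewrite add0r !eqxx.
Qed.

End Dynamics.

(** * Normality and the frontier *)

Section Fatou.
Context (R : realType).
Local Notation N := (@cnorm R).
Local Notation C := (Cplx R).
Implicit Types (h : R[i] -> R[i]) (z u p : R[i]).

(** A countable base of discs with rational centres. Codes that decode to nothing receive radius
    [0], hence an empty disc. *)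
Lemma dense_balls : exists (q : nat -> R[i]) (s : nat -> R), forall p (e : R), 0 < e ->
  exists n, N (p - q n) < s n /\ forall u, N (u - q n) < s n -> N (u - p) < e.
Proof.
exists (fun n => if @unpickle (rat * rat * nat)%type n is Some (a, b, _)
                 then Complex (ratr a) (ratr b) else 0),
       (fun n => if @unpickle (rat * rat * nat)%type n is Some (_, _, m)
                 then m.+1%:R^-1 else 0) => p e e0.
have [m hm] : exists m : nat, m.+1%:R^-1 <= e / 2.
  exists (Num.bound (e / 2)^-1).
  rewrite -[leRHS]invrK lef_pV2 ?posrE ?invr_gt0 ?ltr0n ?divr_gt0//.
  apply/ltW; apply: lt_le_trans (archi_boundP _) _; first by rewrite invr_ge0 divr_ge0// ltW.
  by rewrite ler_nat.
set d : R := m.+1%:R^-1 in hm *; have d0 : 0 < d by rewrite invr_gt0 ltr0n.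
have approx x : exists a : rat, `|x - ratr a| < d / 2.
  have [|a] := @rat_in_itvoo R (x - d / 2) (x + d / 2); first lra.
  rewrite in_itv /= => /andP[a1 a2]; exists a.
  by rewrite ltr_norml; apply/andP; split; lra.
have [a ha] := approx (complex.Re p); have [b hb] := approx (complex.Im p).
exists (pickle (a, b, m)); rewrite pickleK -/d.
have pd : N (p - Complex (ratr a) (ratr b)) < d.
  apply: le_lt_trans (cnorm_le_ReIm _) _; case: p ha hb => x y /=; lra.
split=> // u hu; apply: le_lt_trans (cnormD3 _ (Complex (ratr a) (ratr b)) _) _.
by rewrite (cnormB _ p); lra.
Qed.

Lemma iter_fexp h n (z : C) :
  iter n.+1 (fun w : C => h (cexp w) : C) z = h (orb h n (cexp z)).
Proof. by elim: n => [//|n IH]; rewrite iterS IH orbS. Qed.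

Lemma far_orbit_near h (p : C) (M : nat) : polylim h ->
  (forall n, 2 < N (h (orb h n p))) -> exists2 e : R, 0 < e &
  forall u, N (u - p) < e -> forall n, (n < M)%N -> 2 < N (h (orb h n u)).
Proof.
move=> Fh hp; elim: M => [|M [e e0 he]]; first by exists 1.
have /continuous_cnormP :=
  @polylim_continuous R _ (polylim_comp Fh (polylim_orb M Fh)) p.
move=> /(_ (N (h (orb h M p)) - 2)) [|d d0 hd]; first by rewrite subr_gt0.
exists (Num.min e d) => [|u]; first by rewrite lt_min e0.
rewrite lt_min => /andP[u1 u2] n; rewrite ltnS leq_eqVlt => /predU1P[->|]; last exact: he.
have h1 := hd u u2; have := cnormB_ge (h (orb h M p)) (h (orb h M u)).
by rewrite cnormB; lra.
Qed.

(** The disc determines the index [n], so a large [n] cannot be requested directly. But near [p] the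
    values at all times below [M] exceed [2] by continuity, and a return close enough to [p] must
    therefore happen at time [M] or later. *)
Lemma returns_near (K : set C) h (q : nat -> R[i]) (s : nat -> R) (p : C) : polylim h ->
  (forall p (e : R), 0 < e -> exists n, N (p - q n) < s n /\
    forall u, N (u - q n) < s n -> N (u - p) < e) ->
  (forall n, meets_frontier K (q n) (s n) ->
    exists u, N (u - q n) < s n /\ N (h (orb h n u)) <= 2) ->
  (forall n x, K x -> 2 < N (h (orb h n x))) ->
  K p -> closure (~` K) p -> forall (e : R) M, 0 < e ->
  exists n u, [/\ (M <= n)%N, N (u - p) < e & N (h (orb h n u)) <= 2].
Proof.
move=> Fh dense ret far Kp Cp e M e0.
have [d d0 hd] := far_orbit_near M Fh (fun n => far n p Kp).
have [|n [pn hn]] := dense p (Num.min e d); first by rewrite lt_min e0.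
have [|u [un hu]] := ret n; first by exists p.
have := hn u un; rewrite lt_min => /andP[ue ud].
exists n, u; split => //; rewrite leqNgt; apply/negP => /(hd u ud).
by rewrite ltNge hu.
Qed.

(** Continuity of the limit function is avoided: at one and the same point [w] near [z], a fixed
    large iterate and a later one are both chordally close to [g w], while the first has modulus at
    least 11 and the second at most 2. *)
Lemma not_fatou h (z : C) : polylim h ->
  (forall L : R, exists M, forall n, (M <= n)%N -> L <= N (h (orb h n (cexp z)))) ->
  (forall (e : R) M, 0 < e -> exists n u,
    [/\ (M <= n)%N, N (u - cexp z) < e & N (h (orb h n u)) <= 2]) ->
  ~ fatou_set (fun w : C => h (cexp w) : C) z.
Proof.
move=> Fh far ret; set f : C -> C := fun w => _.
move=> [U [oU Uz normal]].
have [r r0 hr] := (open_cnormP U).1 oU z Uz.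
(* Normality is tested along the return times only, with returning points that converge to [z]. *)
have close k : exists nw : nat * C, [/\ (k <= nw.1)%N, N (nw.2 - z) < k.+1%:R^-1
    & N (iter nw.1.+1 f nw.2) <= 2].
  have [|d d0 hd] := @cexp_open R z k.+1%:R^-1; first by rewrite invr_gt0 ltr0n.
  have [n [u [kn ud hu]]] := ret d k d0; have [w wz wu] := hd u ud.
  by exists (n, w); split => //=; rewrite -iterS iter_fexp wu.
have {close} /choice[nw hnw] := close.
have [|phi [g [phiS hg]]] := normal (fun k => iterate f (nw k).1.+1).
  by move=> k; exists (nw k).1.+1.
have phi_ge k : (k <= phi k)%N.
  elim: k => // k IH; apply: leq_ltn_trans IH _.
  by have := phiS k.+1 k; rewrite /= leEnat ltnn ltnNge => ->.
pose Bx := [set w : C | `|complex.Re w - complex.Re z| <= r / 4 /\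
  `|complex.Im w - complex.Im z| <= r / 4].
have BxU : Bx `<=` U.
  move=> w [w1 w2]; apply: hr; apply: le_lt_trans (cnorm_le_ReIm _) _.
  by rewrite !raddfB; lra.
have inBx w : N (w - z) <= r / 4 -> Bx w.
  move=> h1; split.
    by rewrite -(raddfB (@complex.Re R)); apply: le_trans (normr_Re _) h1.
  by rewrite -(raddfB (@complex.Im R)); apply: le_trans (normr_Im _) h1.
have [|k1 _ hk1] := hg Bx BxU (@compact_box R z (r / 4)) (1 / 6); first lra.
have [M hM] := far 12; set k0 := maxn k1 M.
set n0 := (nw (phi k0)).1.
have far0 : 12 <= N (h (orb h n0 (cexp z))).
  apply: hM; have [h1 _ _] := hnw (phi k0); apply: leq_trans h1.
  by apply: leq_trans (phi_ge k0); exact: leq_maxr.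
have /continuous_cnormP/(_ 1 ltr01)[d d0 hd] := @polylim_continuous R _
  (polylim_comp Fh (polylim_comp (polylim_orb n0 Fh) (@polylim_cexp R))) z.
pose b := Num.min d (r / 4); have b0 : 0 < b by rewrite lt_min d0 divr_gt0.
(* With [l] this large, the returning point is so near [z] that the fixed iterate of order [n0.+1]
   moves by less than [1]. *)
pose l := maxn k1 (Num.bound b^-1).
have wl : N ((nw (phi l)).2 - z) < b.
  have [_ h2 _] := hnw (phi l); apply: lt_trans h2 _.
  rewrite -[b]invrK ltf_pV2 ?posrE ?invr_gt0 ?ltr0n//.
  apply: lt_le_trans (archi_boundP _) _; first by rewrite invr_ge0 ltW.
  rewrite ler_nat; apply: leqW; apply: leq_trans (phi_ge l); exact: leq_maxr.
set w := (nw (phi l)).2 in wl; move: wl; rewrite lt_min => /andP[wd wr].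
have Bw : Bx w by apply: inBx; exact: ltW.
apply: (@chordal_separated R (iter n0.+1 f w) (iter (nw (phi l)).1.+1 f w) (g w)).
- rewrite iter_fexp; have h1 := hd w wd.
  have := cnormB_ge (h (orb h n0 (cexp z))) (h (orb h n0 (cexp w))).
  by rewrite cnormB; lra.
- by have [_ _] := hnw (phi l).
- by apply: (hk1 k0) => //=; exact: leq_maxl.
- by apply: (hk1 l) => //=; exact: leq_maxl.
Qed.

Lemma cvg_compacts_infty (f : C -> C) (U : set C) :
  (forall n z, U z -> n%:R <= N (iter n.+1 f z)) ->
  forall m : nat -> nat, (forall M, exists k0, forall k, (k0 <= k)%N -> (M <= m k)%N) ->
  cvg_compacts U (fun k => iterate f (m k)) (fun=> None).
Proof.
move=> far m hm K KU _ e e0.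
have [k0 hk0] := hm (Num.bound (4 / e)).+2; exists k0 => // k /= /hk0 mk z Kz.
have {mk} [n mn hn] : exists2 n, m k = n.+1 & ((Num.bound (4 / e)).+1 <= n)%N.
  have mk0 : (0 < m k)%N by exact: leq_ltn_trans mk.
  by exists (m k).-1; [rewrite prednK|rewrite -ltnS prednK].
have x0 : 0 < 4 / e by rewrite divr_gt0.
have x1 : 4 / e <= N (iter (m k) f z).
  rewrite mn; apply: le_trans (far n z (KU _ Kz)).
  apply/ltW; apply: lt_le_trans (archi_boundP (ltW x0)) _.
  by rewrite ler_nat ltnW.
apply: le_lt_trans (chordal_infty_le x0 x1) _.
by have -> : 2 / (4 / e) = e / 2 by [field; rewrite gt_eqF]; lra.
Qed.

(** The exponents of a sequence of iterates either tend to infinity, and then so do the iterates, or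
    take one value infinitely often, which gives a constant subsequence. *)
Lemma normal_infty (f : C -> C) (U : set C) :
  (forall n z, U z -> n%:R <= N (iter n.+1 f z)) ->
  normal_family U [set iterate f n | n in [set n | (1 <= n)%N]].
Proof.
move=> far s hs.
have /choice[m hm] : forall k, exists n, s k = iterate f n.
  by move=> k; have [n _ <-] := hs k; exists n.
have [hinf|] := pselect (forall M, exists k0, forall k, (k0 <= k)%N -> (M <= m k)%N).
  exists id, (fun=> None); split => //.
  have -> : s \o id = fun k => iterate f (m k) by apply/funext => k; exact: hm.
  exact: cvg_compacts_infty.
move=> /existsNP[M hM].
have [|v /extraction[phi [phiS hphi]]] := @bounded_infinitely_often m M.
  move=> k0; apply: contrapT => h; apply: hM; exists k0 => k kk.
  by rewrite leqNgt; apply/negP => mk; apply: h; exists k.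
exists phi, (iterate f v); split => // K KU _ e e0; exists 0%N => // k _ z Kz /=.
by rewrite hm hphi /iterate /chordal subrr cnorm0 mulr0 mul0r.
Qed.

Lemma limit_value_infty (f : C -> C) (U : set C) (a : sphere R) : U !=set0 ->
  (forall n z, U z -> n%:R <= N (iter n.+1 f z)) ->
  limit_value f U a <-> a = None.
Proof.
move=> [z0 Uz0] far; split; last first.
  move=> ->; exists id; split => //.
  by apply: (@cvg_compacts_infty f U far id) => M; exists M.
move=> [phi [phiS hphi]]; case: a hphi => // w hphi; exfalso.
have w0 := cnorm_ge0 w.
have e0 : 0 < 1 / (1 + N w) by rewrite divr_gt0//; lra.
have [||k0 _ hk0] := hphi [set z0] _ _ _ e0; [by move=> _ ->|exact: compact_set1|].
have phi_ge k : (k <= phi k)%N.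
  elim: k => // k IH; apply: leq_ltn_trans IH _.
  by have := phiS k.+1 k; rewrite /= leEnat ltnn ltnNge => ->.
pose b := 2 * N w + 1; have b0 : 0 <= b by rewrite /b; lra.
pose k := maxn k0 (Num.bound b).+1.
have := hk0 k (leq_maxl _ _) z0 erefl; apply/negP; rewrite -leNgt.
apply: chordal_fin_far; rewrite -/b.
have kp : (Num.bound b < phi k)%N by apply: leq_trans (phi_ge k); exact: leq_maxr.
rewrite -(ltn_predK kp); apply: le_trans (far _ _ Uz0).
apply/ltW; apply: lt_le_trans (archi_boundP b0) _.
by rewrite ler_nat -ltnS (ltn_predK kp).
Qed.

End Fatou.

(** * The wandering domain *)

Section Assembly.
Context (R : realType).
Local Notation N := (@cnorm R).
Local Notation C := (Cplx R).

(** The last hypothesis makes [U] closed relative to [F], so its trace on the component of [x] is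
    clopen and must be all of it. *)
Lemma component_eq (T : topologicalType) (F U : set T) (x : T) : U x -> U `<=` F ->
  connected U -> open U -> F `&` closure U `<=` U -> U = connected_component F x.
Proof.
move=> Ux UF cU oU clU; apply/seteqP; split; first exact: connected_component_max.
have CF : connected_component F x `<=` F by exact: connected_component_sub.
have <- : connected_component F x `&` U = connected_component F x.
  apply: component_connected.
  - by exists x; split => //; apply: connected_component_refl; exact: UF.
  - by exists U.
  - exists (closure U); first exact: closed_closure.
    apply/seteqP; split => y [Cy Uy]; split => //; first exact: subset_closure.
    by apply: clU; split => //; exact: CF.
exact: subIsetr.
Qed.

Lemma cexp_fiber_infinite (h : C -> C) (O : set C) (z : C) : (@cexp R @^-1` O) z ->
  infinite_set ((@cexp R @^-1` O) `&` (fun w : C => h (cexp w) : C) @^-1` [set h (cexp z)]).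
Proof.
move=> Oz fin; apply: infinite_nat.
pose g (k : nat) : C := z + k%:R * Complex 0 (pi *+ 2).
have ginj : {in [set: nat] &, injective g}.
  move=> i j _ _ /addrI/mulIf gij; apply/eqP; rewrite -(eqr_nat R[i]).
  apply/eqP; apply: gij; rewrite eq_complex /= eqxx /= mulrn_eq0/=.
  by rewrite gt_eqF ?pi_gt0.
rewrite -(eq_finite_set (inj_card_eq ginj)).
apply: sub_finite_set fin => _ [k _ <-].
by rewrite /g; split; rewrite /= cexp_2piM.
Qed.

End Assembly.

Theorem theorem3 (R : realType) (Omega0 : set (Cplx R))
    (Omega0_open : open Omega0)
    (Omega0_bounded : bounded_set Omega0)
    (Omega0_connected : connected Omega0)
    (Omega0_regular : regopen Omega0)
    (Omega0_origin : Omega0 0)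
    (Omega0_compl : connected (~` closure Omega0)) :
  let Omega := @cexp R @^-1` Omega0 in
  exists f : Cplx R -> Cplx R,
    entire f /\
    (escaping_wandering_domain f Omega \/
     oscillating_wandering_domain f Omega) /\
    ~ bounded_set Omega /\
    (exists H : set (Cplx R), half_plane H /\ H `<=` Omega) /\
    (forall n : nat, (1 <= n)%N -> bounded_set (iter n f @` Omega)) /\
    (forall w : Cplx R, (f @` Omega) w ->
       infinite_set (Omega `&` f @^-1` [set w])) /\
    (forall n : nat, (1 <= n)%N -> set_inj (f @` Omega) (iter n f)).
Proof.
move=> Omega; set K := closure Omega0.
have [M0 hM0] := (bounded_cnormP Omega0).1 Omega0_bounded.
pose B := `|M0| + 1; have B0 : 0 <= B by rewrite /B; have := normr_ge0 M0; lra.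
have KB (z : R[i]) : K z -> cnorm z <= B.
  move=> /closure_cnormP/(_ 1 ltr01)[w /hM0 hw wz].
  have := cnormB_ge z w; rewrite cnormB /B; have := ler_norm M0; lra.
have OK : Omega0 `<=` K by exact: subset_closure.
have [q [s dense]] := dense_balls R.
have [h [Fh hK hinj hret]] :=
  escaping_function q s (@closed_closure _ Omega0) B0 KB Omega0_compl.
pose f : Cplx R -> Cplx R := fun w => h (cexp w).
have near_ctr n (x : R[i]) : K x -> 8 * n%:R + 7 <= cnorm (h (orb h n x)).
  move=> Kx; have h1 := hK n x Kx; have h2 := ctr_ge0 n B0.
  have := cnormB_ge (ctr B n)%:C (h (orb h n x)); rewrite cnormB cnorm_realp// /ctr; lra.
have far n z : Omega z -> n%:R <= cnorm (iter n.+1 f z).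
  move=> Oz; rewrite iter_fexp; have := near_ctr n _ (OK _ Oz).
  have := ler0n R n; lra.
have oOmega : open Omega.
  by apply: open_comp => // x _; exact: polylim_continuous (@polylim_cexp R) x.
have cOmega : connected Omega by exact: connected_cexp_preimage.
have [r r0 hr] := (open_cnormP Omega0).1 Omega0_open _ Omega0_origin.
have left z : complex.Re z < ln r -> Omega z.
  by move=> hz; apply: hr; rewrite subr0 cnorm_cexp -[ltRHS]lnK ?ltr_expR.
pose z0 : Cplx R := (ln r - 1)%:C.
have Oz0 : Omega z0 by apply: left; rewrite /=; lra.
have OF : Omega `<=` fatou_set f.
  by move=> z Oz; exists Omega; split => //; exact: normal_infty.
have comp : fatou_component f Omega.
  exists z0; first exact: OF.
  apply: component_eq => // z [Fz cz]; apply: contrapT => nOz.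
  have Kz : K (cexp z).
    apply/closure_cnormP => e e0.
    have [d d0 hd] := (continuous_cnormP _ _).1
      (@polylim_continuous R _ (@polylim_cexp R) z) e e0.
    by have [w Ow /hd wz] := (closure_cnormP _ _).1 cz d d0; exists (cexp w).
  (* By regularity [Omega0] is the interior of [K], so a point outside [Omega0] is a limit of points
     outside [K]. *)
  have Cz : closure (~` K) (cexp z).
    by rewrite closure_setC /= -/(interior K) Omega0_regular.
  apply: (not_fatou Fh _ _ Fz).
    move=> L; exists (Num.bound `|L|) => n hn; apply: le_trans (ler_norm _) _.
    have : `|L| <= n%:R.
      by apply/ltW; apply: lt_le_trans (archi_boundP (normr_ge0 _)) _; rewrite ler_nat.
    have := near_ctr n _ Kz; have := ler0n R n; lra.
  move=> e M e0; apply: (returns_near Fh dense hret _ Kz Cz) => // n x Kx.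
  by have := near_ctr n x Kx; have := ler0n R n; lra.
have disj m n : (m < n)%N -> (iter m f @` Omega) `&` (iter n f @` Omega) = set0.
  case: n => // n mn; apply/seteqP; split => // x [[z Oz zx] [w Ow wx]].
  have hx : cnorm (x - (ctr B n)%:C) <= 1 / 8.
    by rewrite -wx iter_fexp; apply: hK; exact: OK.
  (* For [m = 0] the point lies in [Omega], yet its real part is about [ctr B n], which makes the
     modulus of its exponential exceed [B]. *)
  case: m mn zx => [_ /= zx|m mn zx].
    have := KB _ (OK _ Oz); rewrite zx cnorm_cexp.
    have := le_trans (normr_Re _) hx; rewrite raddfB /= ler_norml => /andP[x1 _].
    have := expR_ge1Dx (complex.Re x); have := ler0n R n; rewrite /ctr in x1; lra.
  have hm : cnorm (x - (ctr B m)%:C) <= 1 / 8.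
    by rewrite -zx iter_fexp; apply: hK; exact: OK.
  have := cnormD3 (ctr B n)%:C x (ctr B m)%:C; rewrite (cnormB _ x) -rmorphB cnorm_real.
  have : 1 + m%:R <= n%:R :> R by rewrite nat1r ler_nat.
  have := ler_norm (ctr B n - ctr B m); rewrite /ctr; lra.
exists f; split; first exact: polylim_entire (polylim_comp Fh (@polylim_cexp R)).
split; [left; split; [split => //|]|].
- move=> m n /eqP; rewrite neq_ltn => /orP[mn|nm]; first exact: disj.
  by rewrite setIC; exact: disj.
- by move=> a; apply: limit_value_infty => //; exists z0.
split.
  move=> /bounded_cnormP[M hM].
  have lnr := ler_norm (ln r); have ln_ge0 := normr_ge0 (ln r).
  have Mn := ler_norm M; have M_ge0 := normr_ge0 M.
  have := hM (ln r - 1 - `|M| - `|ln r|)%:C; rewrite cnorm_real.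
  have /[swap] /[apply] : Omega (ln r - 1 - `|M| - `|ln r|)%:C by apply: left; rewrite /=; lra.
  by have := ler_norm (- (ln r - 1 - `|M| - `|ln r|)); rewrite normrN; lra.
split.
  exists [set z | complex.Re (1 * z) < ln r]; split; last first.
    by move=> z; rewrite /= mul1r; exact: left.
  by exists 1, (ln r); split => //; exact: oner_neq0.
split.
  case=> // n _; apply/bounded_cnormP; exists (ctr B n + 1 / 8) => _ [z Oz <-].
  rewrite iter_fexp; have := hK n _ (OK _ Oz).
  have := cnormB_ge (h (orb h n (cexp z))) (ctr B n)%:C.
  by rewrite (cnorm_realp (ctr_ge0 n B0)); lra.
split.
  by move=> _ [z Oz <-]; exact: cexp_fiber_infinite.
move=> [//|n] _ _ _ /set_mem[x Ox <-] /set_mem[y Oy <-].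
(* Applying [cexp] to both sides turns the equality into one between values of [orb], which is
   injective on [K]. This yields [cexp x = cexp y], enough for [f x = f y] though not for
   [x = y]. *)
rewrite -!iterSr !iter_fexp => e; rewrite /f; congr h.
apply: (hinj n.+1); rewrite ?inE; [exact: OK|exact: OK|].
by rewrite !orbS e.
Qed.
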